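(* There is a set $\mathcal{P}$ of prime numbers such that: (i) $P(x)<\log x$ for every real $x>1$, where $P(x)$ denotes the number of elements of $\mathcal{P}$ not exceeding $x$; and (ii) for every positive integer $h$ and every real $N$, there are distinct primes $p,q,r\in\mathcal{P}$, all larger than $N$, such that $A(pqr)=h$ or $A(pqr)=h+1$.
   Context: For a positive integer $n$, let $\Phi_n(x)=\sum_{0\le m\le\varphi(n)}a_m(n)x^m$ be the $n$th cyclotomic polynomial, where $\varphi$ is Euler's totient function. The height of $\Phi_n$ is $A(n)=\max_m|a_m(n)|$. Here $\log$ is the natural logarithm. *)

(* Defs.v *)
From mathcomp Require Import all_boot all_order all_algebra all_field finmap.
From mathcomp Require Import all_classical all_reals all_analysis.

Set Implicit Arguments.
Unset Strict Implicit.
Unset Printing Implicit Defensive.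

Import GRing.Theory Num.Theory.

Local Open Scope classical_set_scope.
Local Open Scope ring_scope.

(* The range m <= totient n is all of the support: 'Phi_n has size (totient n).+1. *)
Definition height (n : nat) : nat :=
  (\max_(m < (totient n).+1) `|(('Phi_n)`_m)%R|)%N.

(* fset_set sends infinite sets to the empty finite set, but the set counted
   here is always finite, being bounded by x. *)
Definition count_upto (R : realType) (P : set nat) (x : R) : nat :=
  #|` fset_set (P `&` [set p : nat | p%:R <= x])|%fset.

(* Main.v *)
(* Let h >= 1, let p be a prime large compared with h, and let q, r be primes with
   h q = 1 mod p, r^-1 = h mod p and r^-1 = h (h + 1) mod q, q > h (h + 1) p, r > p q.
   From Phi_pqr(x) (1 - x^(p q)) = Phi_pq(x^r) (1 + ... + x^(p-1)) (1 - x^q), every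
   coefficient of Phi_pqr is the sum of the truncated coefficients of Phi_pq over p
   indices t / r mod p q, t running through consecutive integers, minus the same sum
   with t replaced by t - q.  Writing indices as x p + y q mod p q, the coefficient 1
   occurs for x < mu, y < h and -1 for x >= mu, y >= h, where mu p + h q = p q + 1.
   As t runs through p consecutive integers y takes each value once, so the positive
   parts of both sums lie in [0, h].  The shift by q preserves x and lowers y by h
   mod p, while points with x >= mu have values of y at distance at least 2 h, so
   the negative parts differ by at most 1, and |coefficient| <= h + 1.  A suitable
   window and truncation make the coefficient at least h.

   The primes q and r come from Dirichlet's theorem, proved by Shapiro's method:
   for a non-principal character the sum of chi(n) Lambda(n) / n over n <= x is O(1)
   or -ln x + O(1) according to whether L(1, chi) is nonzero, at most one L(1, chi)
   can vanish, so such a chi would be real, and real characters are excluded by an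
   elementary estimate.  Finally, a set made of one triple for each pair (h, N) is
   as sparse as desired, since the triples may be chosen arbitrarily large. *)
Require Import Defs.
From mathcomp Require Import all_boot all_order all_algebra all_field finmap.
From mathcomp Require Import all_classical all_reals all_analysis.
From mathcomp Require Import all_fingroup all_solvable all_character complex.
From mathcomp Require Import zify ring lra.

Set Implicit Arguments.
Unset Strict Implicit.
Unset Printing Implicit Defensive.

Import Order.TTheory GRing.Theory Num.Theory Normc.

Local Open Scope classical_set_scope.
Local Open Scope ring_scope.

(** * Divisors and ternary cyclotomic polynomials *)

Lemma perm_divisors_primeM (p a m : nat) : prime p -> ~~ (p %| m)%N -> (0 < m)%N ->
  perm_eq (divisors (p ^ a * m)%N)
    [seq (p ^ j * d)%N | j <- iota 0 a.+1, d <- divisors m].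
Proof.
move=> pp pNm m0; have p0 := prime_gt0 pp.
have pNd d : (d %| m)%N -> ~~ (p %| d)%N.
  by move=> dm; apply: contra pNm => /dvdn_trans; apply.
have logE j d : d \in divisors m -> logn p (p ^ j * d) = j.
  rewrite -dvdn_divisors // => dm; have d0 := dvdn_gt0 m0 dm.
  by rewrite lognM ?expn_gt0 ?p0 // pfactorK // lognE pp d0 (negbTE (pNd _ dm)) addn0.
apply: uniq_perm; first exact: divisors_uniq.
  apply: allpairs_uniq; [exact: iota_uniq|exact: divisors_uniq|].
  cbv zeta => _ _ /allpairsP[[u v] [_ vm ->]] /allpairsP[[u' v'] [_ v'm ->]] /= e.
  have uu : u = u' by rewrite -(logE u v) // e logE.
  by congr (_, _) => //; move: e; rewrite uu => /eqP; rewrite eqn_pmul2l ?expn_gt0 ?p0 // => /eqP.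
move=> d; rewrite -dvdn_divisors ?muln_gt0 ?expn_gt0 ?p0 //.
apply/idP/idP => [dpm|/allpairsP[[j e] [+ + ->]]]; last first.
  rewrite mem_iota -dvdn_divisors //= add0n ltnS => ja em.
  by rewrite dvdn_mul // dvdn_exp2l.
have d0 : (0 < d)%N by rewrite (dvdn_gt0 _ dpm) // muln_gt0 expn_gt0 p0.
have [e pNe de] := pfactor_coprime pp d0.
apply/allpairsP; exists (logn p d, e); rewrite mem_iota -dvdn_divisors //= add0n ltnS; split.
- by rewrite -(pfactorK a pp) -[leqRHS]addn0 -(_ : logn p m = 0%N) -?lognM ?expn_gt0 ?p0 ?dvdn_leq_log ?muln_gt0 ?expn_gt0 ?p0 // lognE pp m0 (negbTE pNm).
- have : (e %| p ^ a * m)%N by apply: dvdn_trans dpm; rewrite de dvdn_mulr.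
  by rewrite Gauss_dvdr // coprimeXr // coprime_sym.
- by rewrite mulnC.
Qed.

Lemma big_divisors_primeM (R : Type) (idx : R) (op : Monoid.com_law idx)
    (p a m : nat) (F : nat -> R) : prime p -> ~~ (p %| m)%N -> (0 < m)%N ->
  \big[op/idx]_(d <- divisors (p ^ a * m)%N) F d =
  \big[op/idx]_(j < a.+1) \big[op/idx]_(d <- divisors m) F (p ^ j * d)%N.
Proof.
move=> pp pNm m0; rewrite (perm_big _ (perm_divisors_primeM a pp pNm m0)) big_allpairs_dep.
by rewrite -(big_mkord xpredT (fun j => \big[op/idx]_(d <- divisors m) F (p ^ j * d)%N)) /index_iota subn0.
Qed.

Lemma big_divisors_prime (R : Type) (idx : R) (op : Monoid.com_law idx)
    (p : nat) (F : nat -> R) : prime p ->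
  \big[op/idx]_(d <- divisors p) F d = op (F 1%N) (F p).
Proof.
move=> pp; rewrite -[p in divisors p]muln1 -[p in divisors (p * 1)%N]expn1.
rewrite big_divisors_primeM ?dvdn1 ?neq_ltn ?prime_gt1 ?orbT //.
rewrite !big_ord_recr big_ord0 Monoid.mul1m /= (_ : divisors 1 = [:: 1%N]) //.
by rewrite !big_seq1 expn0 expn1 !muln1.
Qed.

Lemma Phi_prime_prime (p q : nat) : prime p -> prime q -> p <> q ->
  'Phi_1 * 'Phi_p * ('Phi_q * 'Phi_(p * q)) = 'X^(p * q) - 1.
Proof.
move=> pp pq npq.
rewrite -prod_Cyclotomic ?muln_gt0 ?prime_gt0 // mulnC -[q in divisors (q * p)%N]expn1.
rewrite big_divisors_primeM ?prime_gt0 ?dvdn_prime2 //; last by apply/eqP=> /esym.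
by rewrite !big_ord_recr big_ord0 /= !big_divisors_prime //=
  expn0 expn1 !muln1 !mul1n mul1r [(q * p)%N]mulnC.
Qed.

Lemma Phi_prime3 (p q r : nat) : prime p -> prime q -> prime r ->
  p <> q -> p <> r -> q <> r ->
  'X^(p * q * r) - 1 =
  ('X^(p * q) - 1) * ('Phi_r * 'Phi_(p * r) * ('Phi_(q * r) * 'Phi_(p * q * r))).
Proof.
move=> pp pq pr npq npr nqr; have r0 := prime_gt0 pr.
rewrite -prod_Cyclotomic ?muln_gt0 ?prime_gt0 // mulnC -[r in divisors (r * _)%N]expn1.
rewrite big_divisors_primeM ?muln_gt0 ?prime_gt0 //; last first.
  by rewrite Euclid_dvdM // !dvdn_prime2 // negb_or; apply/andP; split; apply/eqP => /esym.
rewrite !big_ord_recr big_ord0 /= mul1r; congr (_ * _).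
  rewrite -(prod_Cyclotomic (n := (p * q)%N)) ?muln_gt0 ?prime_gt0 //.
  by apply: eq_bigr => d _; rewrite mul1n.
rewrite [(p * q)%N]mulnC -[q in divisors (q * p)%N]expn1.
rewrite big_divisors_primeM ?prime_gt0 ?dvdn_prime2 //; last by apply/eqP=> /esym.
rewrite !big_ord_recr big_ord0 /= !big_divisors_prime //=.
rewrite !expn0 !expn1 !muln1 !mul1n mul1r [(r * p)%N]mulnC [(r * q)%N]mulnC.
by rewrite [(r * _)%N]mulnC.
Qed.

(** * Reducing Phi_pqr to Phi_pq *)

Lemma Xn_sub1_neq0 (R : nzRingType) n : (0 < n)%N -> 'X^n - 1 != 0 :> {poly R}.
Proof. by move=> n0; rewrite -polyC1 -size_poly_gt0 size_XnsubC. Qed.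

(** [G] stands for Phi_pq and enters only through the identity that characterises it, so an explicit
    signed sum of monomials can take its place directly. *)
Lemma Phi_pqr_mul (p q r : nat) (G : {poly int}) : prime p -> prime q -> prime r ->
  p <> q -> p <> r -> q <> r ->
  G * ('X^p - 1) * ('X^q - 1) = ('X^(p * q) - 1) * ('X - 1) ->
  'Phi_(p * q * r) * ('X^(p * q) - 1) =
  (G \Po 'X^r) * (\sum_(m < p) 'X^m) * ('X^q - 1).
Proof.
move=> pp pq pr npq npr nqr GE.
have [p0 [q0 r0]] := (prime_gt0 pp, (prime_gt0 pq, prime_gt0 pr)).
have e1 : 'Phi_1 = 'X - 1 :> {poly int}.
  by have := prod_Cyclotomic (n := 1) isT; rewrite big_seq1 expr1.
have e2 s : prime s -> 'Phi_1 * 'Phi_s = 'X^s - 1.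
  move=> ps; rewrite -prod_Cyclotomic ?prime_gt0 // big_divisors_prime //.
have e3 := Phi_prime_prime pp pr npr; have e4 := Phi_prime_prime pq pr nqr.
have e5 := Phi_prime3 pp pq pr npq npr nqr.
have GrE : (G \Po 'X^r) * ('X^(p * r) - 1) * ('X^(q * r) - 1) =
    ('X^(p * q * r) - 1) * ('X^r - 1).
  have := congr1 (comp_poly 'X^r) GE; rewrite !comp_polyM !comp_polyB.
  by rewrite !comp_Xn_poly comp_polyX comp_polyC -!exprM ![(r * _)%N]mulnC.
have UE : (\sum_(m < p) 'X^m) * ('X - 1) = 'X^p - 1 :> {poly int}.
  by rewrite mulrC -subrX1.
have K0 : ('X^(p * r) - 1) * ('X^(q * r) - 1) * ('X - 1) != 0 :> {poly int}.
  by rewrite !mulf_neq0 ?Xn_sub1_neq0 ?muln_gt0 ?p0 ?q0 // -['X]expr1 Xn_sub1_neq0.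
apply: (mulIf K0).
transitivity (((G \Po 'X^r) * ('X^(p * r) - 1) * ('X^(q * r) - 1)) *
  ((\sum_(m < p) 'X^m) * ('X - 1)) * ('X^q - 1)); last by ring.
by rewrite GrE UE e5 -(e2 p pp) -(e2 q pq) -(e2 r pr) -e3 -e4 -e1; ring.
Qed.

(** The left side is the coefficient of x^n in x^j / (1 - x^M); the right side is its recursion in
    steps of M. *)
Lemma leq_eqmodE (M n j : nat) : (0 < M)%N ->
  ((j <= n) && (j == n %[mod M]))%N%:R =
  (if (M <= n)%N then ((j <= n - M) && (j == n - M %[mod M]))%N%:R else 0)
    + (j == n)%:R :> int.
Proof.
move=> M0; case: (leqP M n) => [Mn|nM].
  have [->|jn] := eqVneq j n.
    by rewrite leqnn eqxx (_ : (n <= n - M)%N = false) ?add0r //; lia.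
  have -> : (j == n %[mod M])%N = (j == n - M %[mod M])%N.
    by rewrite -[in LHS](subnK Mn) modnDr.
  rewrite addr0; case: (leqP j (n - M)) => [le_j|nMj] /=.
    by rewrite (leq_trans le_j) ?leq_subr.
  case: leqP => //= le_jn; case: eqP => // /eqP; rewrite eqn_mod_dvd ?(ltnW nMj) //.
  by case/dvdnP=> -[|k]; rewrite ?mulSn; lia.
rewrite add0r; congr ((nat_of_bool _)%:R).
apply/andP/eqP => [[jn]|->]; last by split.
by rewrite !modn_small ?(leq_ltn_trans jn) // => /eqP.
Qed.

(* Divides by 1 - X^M as a power series; since r >= M, the truncation of the
   resulting sum depends on k j only, not on m. *)
Lemma coef_lacunary (J : finType) (s : J -> int) (k : J -> nat) (P : {poly int})
    (M p q r n : nat) :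
  (p + q <= M)%N -> (M <= r)%N -> (0 < p)%N ->
  P * ('X^M - 1) =
    (\sum_j s j *: 'X^(r * k j)) * (\sum_(m < p) 'X^m) * ('X^q - 1) ->
  P`_n = \sum_(m < p) \sum_j s j *
    (((k j <= n %/ r) && (r * k j + m == n %[mod M]))%N%:R -
     ((k j <= n %/ r) && (r * k j + m + q == n %[mod M]))%N%:R).
Proof.
move=> pqM Mr p0 PE; have M0 : (0 < M)%N by lia.
have r0 : (0 < r)%N by lia.
(* Only [k j] = n / r needs care: there n = r k + n0, and n0 < e < M would make n0 and e distinct
   residues modulo M, against the congruence. *)
have truncE j (e : nat) : (e < M)%N ->
    ((k j <= n %/ r) && (r * k j + e == n %[mod M]))%N =
    ((r * k j + e <= n) && (r * k j + e == n %[mod M]))%N.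
  move=> eM; apply/andP/andP => -[le1 eqM]; split => //; last first.
    by rewrite leq_divRL //; lia.
  have [n0 [nE n0r]] : exists n0, n = (n %/ r * r + n0)%N /\ (n0 < r)%N.
    by exists (n %% r)%N; rewrite -divn_eq ltn_mod.
  have [ltT|eqT] : (k j < n %/ r)%N \/ k j = (n %/ r)%N by lia.
    rewrite nE; nia.
  rewrite leqNgt; apply/negP => lt_n; move: eqM.
  rewrite [in X in _ == X]nE -eqT [(r * k j)%N]mulnC eqn_modDl.
  rewrite !modn_small //; move: lt_n; rewrite [in X in (X < _)%N]nE -eqT [(r * k j)%N]mulnC; lia.
transitivity (\sum_(m < p) \sum_j s j *
    (((r * k j + m <= n) && (r * k j + m == n %[mod M]))%N%:R -
     ((r * k j + m + q <= n) && (r * k j + m + q == n %[mod M]))%N%:R)); last first.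
  apply: eq_bigr => m _; apply: eq_bigr => j _; have := ltn_ord m => mp.
  by rewrite -truncE ?(leq_trans mp) //; [rewrite -!addnA -truncE //; lia|lia].
have {}PE i : (if (M <= i)%N then P`_(i - M) else 0) - P`_i =
    \sum_(m < p) \sum_j s j * ((r * k j + m + q == i)%N%:R - (r * k j + m == i)%N%:R).
  transitivity ((P * ('X^M - 1))`_i).
    rewrite mulrBr mulr1 coefB coefMXn; case: ltnP => // _.
  rewrite PE mulrAC mulr_sumr coef_sum; apply: eq_bigr => m _.
  rewrite -mulrA mulr_suml coef_sum; apply: eq_bigr => j _.
  rewrite -scalerAl coefZ mulrBl mul1r mulrBr -!exprD coefB !coefXn.
  by rewrite ![i == _]eq_sym addnA addnAC.
clear truncE; pose ind (e i : nat) : int := ((e <= i) && (e == i %[mod M]))%N%:R.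
rewrite -/(ind _ _); elim/ltn_ind: n => n IHn.
have -> : P`_n = (if (M <= n)%N then P`_(n - M) else 0) -
    \sum_(m < p) \sum_j s j * ((r * k j + m + q == n)%N%:R - (r * k j + m == n)%N%:R).
  by rewrite -PE opprB addrCA subrr addr0.
have -> : (if (M <= n)%N then P`_(n - M) else 0) =
  \sum_(m < p) \sum_j s j *
    ((if (M <= n)%N then ind (r * k j + m)%N (n - M)%N else 0) -
     (if (M <= n)%N then ind (r * k j + m + q)%N (n - M)%N else 0)).
  case: leqP => Mn; first by rewrite IHn //; lia.
  by rewrite big1 // => m _; rewrite big1 // => j _; rewrite subr0 mulr0.
rewrite -sumrB; apply: eq_bigr => m _; rewrite -sumrB; apply: eq_bigr => j _.
by rewrite -mulrBr /ind !(leq_eqmodE n _ M0) -/ind; congr (_ * _); ring.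
Qed.

(* Write mu p + h q = p q + 1.  The coefficient of 'Phi_(p q) at the exponent
   x p + y q (x < q, y < p, reduced by p q when needed) is [bin_sign mu h x y]. *)
Definition bin_sign (mu h x y : nat) : int :=
  ((x < mu) && (y < h))%N%:R - ((mu <= x) && (h <= y))%N%:R.

Definition bin_exp (p q mu x y : nat) : nat :=
  if (x < mu)%N then (x * p + y * q)%N else (x * p + y * q - p * q)%N.

Lemma sum_pow_lt (e n m : nat) : (m <= n)%N ->
  (\sum_(i < n) (i < m)%N%:R * 'X^(i * e)) * ('X^e - 1) = 'X^(m * e) - 1 :> {poly int}.
Proof.
move=> mn; rewrite mulnC exprM (subrX1 _ m) mulrC; congr (_ * _).
rewrite (big_ord_widen n (fun i => ('X^e : {poly int}) ^+ i)) // [RHS]big_mkcond /=.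
by apply: eq_bigr => i _; case: ltnP; rewrite ?mul1r ?mul0r // mulnC exprM.
Qed.

Lemma sum_pow_ge (e n m : nat) : (m <= n)%N ->
  (\sum_(i < n) (m <= i)%N%:R * 'X^(i * e)) * ('X^e - 1) =
  'X^(n * e) - 'X^(m * e) :> {poly int}.
Proof.
move=> mn; transitivity (('X^(n * e) - 1) - ('X^(m * e) - 1) : {poly int}); last by ring.
rewrite -(sum_pow_lt e (leqnn n)) -(sum_pow_lt e mn) -mulrBl -sumrB.
congr (_ * _); apply: eq_bigr => i _.
by rewrite ltn_ord -mulrBl; congr (_ * _); case: ltnP; rewrite ?subrr ?subr0.
Qed.

Lemma bin_poly_mul (p q h mu : nat) : (0 < p * q)%N -> (mu <= q)%N -> (h <= p)%N ->
  (mu * p + h * q = p * q + 1)%N ->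
  (\sum_(j : 'I_q * 'I_p) bin_sign mu h j.1 j.2 *: 'X^(bin_exp p q mu j.1 j.2))
    * ('X^p - 1) * ('X^q - 1) = ('X^(p * q) - 1) * ('X - 1).
Proof.
move=> pq0 muq hp e1; set G := \sum_j _.
(* The factor x^(p q) clears the subtraction in [bin_exp]; the blocks of signs 1 and -1 then become
   products of two truncated geometric sums. *)
have GE : 'X^(p * q) * G =
    (\sum_(x < q) (x < mu)%N%:R * 'X^(x * p)) * (\sum_(y < p) (y < h)%N%:R * 'X^(y * q))
      * 'X^(p * q)
    - (\sum_(x < q) (mu <= x)%N%:R * 'X^(x * p)) *
      (\sum_(y < p) (h <= y)%N%:R * 'X^(y * q)).
  rewrite mulr_sumr !big_distrlr /= !pair_bigA mulr_suml -sumrB.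
  apply: eq_bigr => -[x y] _ /=; rewrite /bin_sign /bin_exp.
  case: ltnP => mx; case: ltnP => hy /=;
    rewrite ?mul0r ?mulr0 ?mul1r ?subr0 ?sub0r ?subrr ?scale0r ?scale1r ?scaleN1r ?oppr0 ?mulr0 ?mul0r //.
    by rewrite exprD mulrC.
  (* Here x p + y q >= mu p + h q = p q + 1, so the natural subtraction is exact. *)
  rewrite mulrN -!exprD; congr (- 'X^_); nia.
apply: (@mulfI _ 'X^(p * q)); first by rewrite monic_neq0 ?monicXn.
rewrite !mulrA GE.
transitivity (((\sum_(x < q) (x < mu)%N%:R * 'X^(x * p)) * ('X^p - 1)) *
   ((\sum_(y < p) (y < h)%N%:R * 'X^(y * q)) * ('X^q - 1)) * 'X^(p * q)
 - ((\sum_(x < q) (mu <= x)%N%:R * 'X^(x * p)) * ('X^p - 1)) *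
   ((\sum_(y < p) (h <= y)%N%:R * 'X^(y * q)) * ('X^q - 1)) : {poly int}); first by ring.
rewrite !sum_pow_lt // !sum_pow_ge // [(q * p)%N]mulnC.
have AB : 'X^(mu * p) * 'X^(h * q) = 'X^(p * q) * 'X :> {poly int}.
  by rewrite -exprD e1 exprD expr1.
transitivity ('X^(mu * p) * 'X^(h * q) * ('X^(p * q) - 1) + 'X^(p * q)
  - 'X^(p * q) * 'X^(p * q) : {poly int}); first by ring.
by rewrite AB; ring.
Qed.

Lemma crt_inj (p q r x y x' y' : nat) : coprime p q -> coprime r (p * q) ->
  (x < q)%N -> (x' < q)%N -> (y < p)%N -> (y' < p)%N ->
  (r * (x * p + y * q) = r * (x' * p + y' * q) %[mod p * q])%N ->
  x = x' /\ y = y'.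
Proof.
move=> cpq cr xq x'q yp y'p E.
have {}E : (x * p + y * q == x' * p + y' * q %[mod p * q])%N.
  wlog le_n : x y x' y' {xq x'q yp y'p} E / (x' * p + y' * q <= x * p + y * q)%N => [W|].
    have [/W ->//|/ltnW/W W1] := leqP (x' * p + y' * q) (x * p + y * q).
    by rewrite eq_sym W1.
  move/eqP: E; rewrite eqn_mod_dvd ?leq_mul2l ?le_n ?orbT // -mulnBr.
  by rewrite Gauss_dvdr 1?coprime_sym // -eqn_mod_dvd.
have key s t a b a' b' : coprime s t -> (a < t)%N -> (a' < t)%N ->
    (a * s + b * t == a' * s + b' * t %[mod s * t])%N -> a = a'.
  move=> cst at_ a't /eqP/(congr1 (modn^~ t)); rewrite !modn_dvdm ?dvdn_mull //.
  rewrite ![(_ + _ * t)%N]addnC !modnMDl => /eqP.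
  wlog aa : a a' at_ a't / (a' <= a)%N => [W|].
    by have [/W W1|/ltnW /W W1] := leqP a' a; [exact: W1|rewrite eq_sym => /W1 W2; rewrite W2].
  rewrite eqn_mod_dvd ?leq_mul2r ?aa ?orbT // -mulnBl Gauss_dvdl 1?coprime_sym //.
  by rewrite -eqn_mod_dvd // => /eqP; rewrite !modn_small.
split; first exact: key cpq xq x'q E.
by apply: (key q p y x y' x'); rewrite 1?coprime_sym // [(q * p)%N]mulnC addnC [X in _ == X %[mod _]]addnC.
Qed.

(** [T] will be n / r: a monomial of Phi_pq(x^r) of exponent above n cannot reach the coefficient of
    x^n. *)
Definition bin_trunc (p q mu h T x y : nat) : int :=
  bin_sign mu h x y * (bin_exp p q mu x y <= T)%N%:R.

(** For each m the congruence modulo p q selects a single pair (x, y), so the inner sum of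
    [coef_lacunary] collapses to one term. Both families share [X], since a shift by q is invisible
    modulo q. *)
Lemma coef_Phi_pqr (p q r h L n : nat) (X Y Y' : nat -> nat) :
  prime p -> prime q -> prime r -> p <> q -> (p * q < r)%N ->
  (h * q = L * p + 1)%N -> (h <= p)%N -> (L <= q)%N ->
  (forall m, (m < p)%N -> [/\ (X m < q)%N, (Y m < p)%N, (Y' m < p)%N,
     (r * (X m * p + Y m * q) + m = n %[mod p * q])%N &
     (r * (X m * p + Y' m * q) + m + q = n %[mod p * q])%N]) ->
  ('Phi_(p * q * r))`_n = \sum_(m < p)
    (bin_trunc p q (q - L) h (n %/ r) (X m) (Y m) -
     bin_trunc p q (q - L) h (n %/ r) (X m) (Y' m)).
Proof.
move=> pp pq pr npq pqr hqE hp Lq XYP.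
have [p1 q1] := (prime_gt1 pp, prime_gt1 pq).
have npr : p <> r by nia.
have nqr : q <> r by nia.
have cpq : coprime p q by rewrite prime_coprime // dvdn_prime2 //; apply/eqP.
have cr : coprime r (p * q).
  by rewrite coprimeMr !prime_coprime // !dvdn_prime2 //; apply/andP; split; apply/eqP => /esym.
have pq0 : (0 < p * q)%N by nia.
have e1 : ((q - L) * p + h * q = p * q + 1)%N by rewrite mulnBl hqE; nia.
set mu := (q - L)%N in e1 *; have muq : (mu <= q)%N by exact: leq_subr.
have := Phi_pqr_mul pp pq pr npq npr nqr (bin_poly_mul pq0 muq hp e1).
rewrite raddf_sum /= => PE.
rewrite (coef_lacunary (J := ('I_q * 'I_p)%type) (s := fun j => bin_sign mu h j.1 j.2)
  (k := fun j => bin_exp p q mu j.1 j.2) (M := (p * q)%N) (p := p) (q := q) (r := r) n);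
  [|nia|nia|nia|]; last first.
  rewrite PE; congr (_ * _ * _); apply: eq_bigr => j _.
  by rewrite comp_polyZ comp_Xn_poly exprM.
have sumE (e y0 x0 : nat) : (x0 < q)%N -> (y0 < p)%N ->
   (r * (x0 * p + y0 * q) + e = n %[mod p * q])%N ->
   \sum_(j : 'I_q * 'I_p) bin_sign mu h j.1 j.2 *
     ((bin_exp p q mu j.1 j.2 <= n %/ r) &&
       (r * bin_exp p q mu j.1 j.2 + e == n %[mod p * q]))%N%:R =
   bin_trunc p q mu h (n %/ r) x0 y0.
  move=> x0q y0p E0.
  (* Reducing an exponent by p q does not affect the congruence. Where the sign is 0 the natural
     subtraction might truncate, hence the hypothesis of a nonzero sign. *)
  have expE x y : bin_sign mu h x y != 0 -> (r * bin_exp p q mu x y + e)%N =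
      (r * (x * p + y * q) + e)%N %[mod p * q].
    rewrite /bin_sign /bin_exp; case: ltnP => //= mx; case: ltnP => //= hy _.
    rewrite mulnBr -[in RHS](subnK (m := r * (p * q)) (n := r * (x * p + y * q))).
      by rewrite addnAC [X in _ = X %[mod _]]addnC modnMDl.
    by rewrite leq_mul2l; apply/orP; right; nia.
  rewrite (bigD1 (Ordinal x0q, Ordinal y0p)) //= big1 ?addr0.
    rewrite /bin_trunc; have [->|s0] := eqVneq (bin_sign mu h x0 y0) 0.
      by rewrite !mul0r.
    by rewrite expE // E0 eqxx andbT.
  move=> -[x y] /= nxy; have [->|s0] := eqVneq (bin_sign mu h x y) 0.
    by rewrite mul0r.
  rewrite expE //; case: eqP => [E|]; rewrite ?andbF ?mulr0 //.
  case/eqP: nxy; have /eqP := etrans E (esym E0); rewrite eqn_modDr => /eqP.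
  by case/(crt_inj cpq cr) => // xx yy; congr (_, _); apply: val_inj.
apply: eq_bigr => m _; have [Xq Yp Y'p E1 E2] := XYP m (ltn_ord m).
under eq_bigr do rewrite mulrBr -addnA.
by rewrite sumrB (sumE m (Y m) (X m)) // -(sumE (m + q)%N (Y' m) (X m)) ?addnA //.
Qed.

(** * The coefficients for r^-1 = h mod p and r^-1 = h (h + 1) mod q *)

Lemma crt_surj (p q r t : nat) : (0 < p * q)%N -> coprime p q -> coprime r (p * q) ->
  exists x y : nat, [/\ (x < q)%N, (y < p)%N &
    (r * (x * p + y * q) = t %[mod p * q])%N].
Proof.
move=> pq0 cpq cr.
pose f (u : 'I_q * 'I_p) : 'I_(p * q) :=
  Ordinal (ltn_pmod (r * (u.1 * p + u.2 * q))%N pq0).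
have f_inj : injective f.
  move=> [x y] [x' y'] /(congr1 val) /= /(crt_inj cpq cr).
  by case=> // xx yy; congr (_, _); apply: val_inj.
have le_card : (#|'I_(p * q)| <= #|{: 'I_q * 'I_p}|)%N.
  by rewrite card_prod !card_ord mulnC.
have /codomP[[x y] /(congr1 val) /= E] :=
  inj_card_onto f_inj le_card (Ordinal (ltn_pmod t pq0)).
by exists x, y; split.
Qed.

Lemma dvdz_small (p a : int) : (p %| a)%Z -> `|a| < p -> a = 0.
Proof. by case/dvdzP=> k -> ?; have [->|k0] := eqVneq k 0; [rewrite mul0r|nia]. Qed.

Lemma modn_dvdz (d a b : nat) : (a = b %[mod d])%N -> (d %| a%:Z - b%:Z)%Z.
Proof.
by move/eqP=> E; rewrite -eqz_mod_dvd; apply/eqP; rewrite !modz_nat; move/eqP: E => ->.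
Qed.

(** Modulo q the hypothesis reads r x p = t, with r^-1 = h (h + 1); modulo p it reads r y q = t,
    with r^-1 = q^-1 = h. *)
Lemma crt_coords (p q r h L x y : nat) (t : int) :
  (h * q = L * p + 1)%N -> (r * h = 1 %[mod p])%N -> (r * (h * h.+1) = 1 %[mod q])%N ->
  ((p * q)%N %| (r * (x * p + y * q))%N%:Z - t)%Z ->
  (q %| x%:Z * p - h%:Z * (h%:Z + 1) * t)%Z /\ (p %| y%:Z - h%:Z ^+ 2 * t)%Z.
Proof.
move=> hqE rp rq /dvdzP[k kE].
have /dvdzP[a aE] := modn_dvdz rp; have /dvdzP[b bE] := modn_dvdz rq.
have tE : t = (r * (x * p + y * q))%N%:Z - k * (p * q)%N by rewrite -kE; ring.
have {}hqE : h%:Z * q = L%:Z * p + 1 by lia.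
have {}aE : r%:Z * h = a * p + 1 by lia.
have {}bE : r%:Z * (h%:Z * (h%:Z + 1)) = b * q + 1.
  by rewrite -(subrK 1 (r%:Z * _)) -bE; congr (_ + _); lia.
have subE (u v : int) : u - v = 0 -> u = v by move/eqP; rewrite subr_eq0 => /eqP.
split; apply/dvdzP.
  exists (- (b * x%:Z * p%:Z) - h%:Z * (h%:Z + 1) * (r%:Z * y%:Z - k * p%:Z)); apply: subE.
  transitivity (- (x%:Z * p%:Z) * (r%:Z * (h%:Z * (h%:Z + 1)) - (b * q%:Z + 1))).
    by rewrite tE !PoszM PoszD !PoszM; ring.
  by rewrite bE subrr mulr0.
exists (- (r%:Z * h%:Z * h%:Z * x%:Z) - (a * h%:Z * q%:Z * y%:Z + y%:Z * L%:Z)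
   + k * q%:Z * h%:Z * h%:Z); apply: subE.
transitivity (y%:Z * (L%:Z * p%:Z + 1 - h%:Z * q%:Z)
   - y%:Z * h%:Z * q%:Z * (r%:Z * h%:Z - (a * p%:Z + 1))).
  by rewrite tE !PoszM PoszD !PoszM; ring.
by rewrite aE hqE !subrr !mulr0 subrr.
Qed.

(* With d = t - t', the x-coordinates give h (h+1) d = p (x - x') + q e with
   |e| <= h; modulo p this reads (h+1) s = -e, and h + 1 > |e| forces s = 0. *)
Lemma hits_spaced (h L p q x x' : nat) (t t' s : int) :
  prime p -> (0 < h)%N -> (4 * h.+1 ^ 3 < p)%N -> (h * h.+1 * p < q)%N ->
  (h * q = L * p + 1)%N ->
  (q - L <= x < q)%N -> (q - L <= x' < q)%N ->
  (q %| x%:Z * p - h%:Z * (h%:Z + 1) * t)%Z ->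
  (q %| x'%:Z * p - h%:Z * (h%:Z + 1) * t')%Z ->
  (p %| s - h%:Z ^+ 2 * (t - t'))%Z -> `|s| < 2 * h%:Z -> `|t - t'| < p%:Z -> t = t'.
Proof.
move=> pp h0 ph qh hqE xE x'E /dvdzP[b bE] /dvdzP[b' b'E] /dvdzP[a aE] sh tt.
pose e := b - b'; pose d := t - t'.
have hqZ : h%:Z * q%:Z = L%:Z * p%:Z + 1 by lia.
have qZ : h%:Z * (h%:Z + 1) * p%:Z < q%:Z by lia.
have h1 : 1 <= h%:Z by lia.
have pZ : 4 * (h%:Z + 1) * (h%:Z + 1) < p%:Z.
  have : (4 * h.+1 * h.+1 < p)%N.
    by apply: leq_ltn_trans ph; rewrite -mulnA leq_mul2l /= mulnn leq_exp2l.
  lia.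
clear ph qh.
have eE : (x%:Z - x'%:Z) * p%:Z = h%:Z * (h%:Z + 1) * d + q%:Z * e.
  transitivity ((x%:Z * p%:Z - h%:Z * (h%:Z + 1) * t)
    - (x'%:Z * p%:Z - h%:Z * (h%:Z + 1) * t') + h%:Z * (h%:Z + 1) * d); first by rewrite /d; ring.
  by rewrite bE b'E /e; ring.
(* Both x and x' lie in an interval of L integers, so |x - x'| p < L p + 1 = h q, while h (h + 1)
   |d| < q; hence q |e| < (h + 1) q. *)
have e_le : `|e| <= h%:Z.
  have xx : `|(x%:Z - x'%:Z) * p%:Z| < h%:Z * q%:Z.
    rewrite normrM (ger0_norm (x := p%:Z)) // hqZ ltzD1 ler_wpM2r //; lia.
  have dd : `|h%:Z * (h%:Z + 1) * d| < q%:Z.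
    rewrite normrM ger0_norm; last by rewrite mulr_ge0 //; lia.
    by apply: le_lt_trans qZ; rewrite ler_wpM2l ?mulr_ge0 ?ltW //; lia.
  have : `|e| * q%:Z < (h%:Z + 1) * q%:Z.
    rewrite -[q%:Z in X in X < _]ger0_norm // -normrM mulrC.
    have -> : q%:Z * e = (x%:Z - x'%:Z) * p%:Z - h%:Z * (h%:Z + 1) * d by rewrite eE; ring.
    by apply: le_lt_trans (ler_normB _ _) _; rewrite [ltRHS]mulrDl mul1r ltrD.
  by rewrite ltr_pM2r ?ltzD1 //; apply: le_lt_trans dd.
have div1 : (p %| (h%:Z + 1) * s + e)%Z.
  apply/dvdzP; exists (h%:Z * (x%:Z - x'%:Z) - L%:Z * e + (h%:Z + 1) * a).
  have sE : s = a * p%:Z + h%:Z ^+ 2 * d by rewrite -aE /d; ring.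
  transitivity ((h%:Z + 1) * s + (h%:Z * q%:Z - L%:Z * p%:Z) * e).
    by rewrite hqZ; ring.
  transitivity ((h%:Z + 1) * s + h%:Z * (q%:Z * e) - L%:Z * p%:Z * e); first by ring.
  have -> : q%:Z * e = (x%:Z - x'%:Z) * p%:Z - h%:Z * (h%:Z + 1) * d by rewrite eE; ring.
  by rewrite sE; ring.
have gs0 : (h%:Z + 1) * s + e = 0.
  apply: (dvdz_small div1); have : `|(h%:Z + 1) * s| <= (h%:Z + 1) * (2 * h%:Z).
    by rewrite normrM ger0_norm ?ler_wpM2l ?ltW //; lia.
  move=> le1; apply: le_lt_trans (ler_normD _ _) _; apply: le_lt_trans (lerD le1 e_le) _.
  apply: le_lt_trans pZ; clear -h1; nia.
have s0 : s = 0 by have [//|s0] := eqVneq s 0; clear -s0 gs0 e_le h1; nia.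
(* Once s = 0, p divides h^2 d; as h < p and |d| < p, this leaves d = 0. *)
have : (p %| h ^ 2 * absz d)%N.
  have -> : (h ^ 2 * absz d)%N = absz (h%:Z ^+ 2 * d) by rewrite abszM abszX.
  have -> : h%:Z ^+ 2 * d = (- a) * p%:Z by rewrite mulNr -aE s0 /d; ring.
  by rewrite abszM dvdn_mull.
have hp : (h < p)%N by clear -pZ h1; nia.
rewrite Euclid_dvdM // Euclid_dvdX // andbT => /orP[|] H.
  by have := dvdn_leq h0 H; lia.
have [|d0] := eqVneq d 0; first by rewrite /d; lia.
by have := dvdn_leq _ H; rewrite /d in d0 *; lia.
Qed.

(** * The upper bound h + 1 for the coefficients *)

Lemma bin_truncE (p q mu h T x y : nat) : bin_trunc p q mu h T x y =
  [&& x < mu, y < h & x * p + y * q <= T]%N%:R -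
  [&& mu <= x, h <= y & x * p + y * q <= T + p * q]%N%:R.
Proof.
rewrite /bin_trunc /bin_sign /bin_exp; case: ltnP => mx; case: ltnP => hy //=;
  rewrite ?leq_subLR ?[(p * q + T)%N]addnC; by case: leq => /=; ring.
Qed.

Lemma sum_bool_le_inj (n h : nat) (f : 'I_n -> nat) (b : pred 'I_n) :
  injective f -> (forall m, b m -> (f m < h)%N) ->
  \sum_m (b m)%:R <= h%:R :> int.
Proof.
move=> f_inj bf; rewrite -natr_sum ler_nat -big_mkcond /= sum1_card.
case: h => [|h] in bf *.
  by rewrite leqn0; apply/eqP/eq_card0 => m; apply/negP => /bf.
rewrite -[leqRHS]card_ord; apply: (leq_card_in (fun m => inord (f m))).
move=> m m' /bf ? /bf ? /(congr1 val) /=; rewrite !inordK //; exact: f_inj.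
Qed.

Lemma sum_le1_uniq (n : nat) (f : 'I_n -> int) (Q : 'I_n -> Prop) :
  (forall m, f m <= 1) -> (forall m, 0 < f m -> Q m) ->
  (forall m m', Q m -> Q m' -> m = m') -> \sum_m f m <= 1.
Proof.
move=> f1 fQ Qu; have [/existsP[m f0]|] := boolP [exists m, 0 < f m]; last first.
  rewrite negb_exists => /forallP fn; apply: le_trans ler01; apply: sumr_le0 => m _.
  by rewrite leNgt fn.
rewrite (bigD1 m) //= -[leRHS]addr0 lerD // sumr_le0 // => m' m'm.
by rewrite leNgt; apply: contra_neqN m'm => /fQ Qm'; apply: Qu => //; apply: fQ.
Qed.

(** Multiplication by h^2 is injective modulo p, so p consecutive values of t give p distinct values
    of y. *)
Lemma residue_inj (p h m m' : nat) (y c : int) : prime p -> (0 < h < p)%N ->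
  (m < p)%N -> (m' < p)%N ->
  (p %| y - h%:Z ^+ 2 * (c - m%:Z))%Z -> (p %| y - h%:Z ^+ 2 * (c - m'%:Z))%Z -> m = m'.
Proof.
move=> pp h0 mp m'p H1 H2; have : (p %| h%:Z ^+ 2 * (m%:Z - m'%:Z))%Z.
  have -> : h%:Z ^+ 2 * (m%:Z - m'%:Z) =
    (y - h%:Z ^+ 2 * (c - m%:Z)) - (y - h%:Z ^+ 2 * (c - m'%:Z)) by ring.
  exact: rpredB.
rewrite dvdzE abszM abszX /= Euclid_dvdM // Euclid_dvdX // andbT => /orP[|] H.
  by have := dvdn_leq _ H; lia.
by have [|] := eqVneq (m%:Z - m'%:Z) 0; [lia|move=> ne0; have := dvdn_leq _ H; lia].
Qed.

(** The sum is regrouped as a difference of two positive parts in [0, h] and a difference of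
    negative parts that lies in [-1, 1]. *)
Lemma coef_upper (h L p q T : nat) (c : int) (X Y Y' : nat -> nat) :
  prime p -> (0 < h)%N -> (4 * h.+1 ^ 3 < p)%N -> (h * h.+1 * p < q)%N ->
  (h * q = L * p + 1)%N ->
  (forall m, (m < p)%N -> [/\ (X m < q)%N, (Y m < p)%N & (Y' m < p)%N]) ->
  (forall m, (m < p)%N -> (q %| (X m)%:Z * p - h%:Z * (h%:Z + 1) * (c - m%:Z))%Z) ->
  (forall m, (m < p)%N -> (p %| (Y m)%:Z - h%:Z ^+ 2 * (c - m%:Z))%Z) ->
  (forall m, (m < p)%N -> (p %| (Y' m)%:Z - h%:Z ^+ 2 * (c - m%:Z - q%:Z))%Z) ->
  `|\sum_(m < p) (bin_trunc p q (q - L) h T (X m) (Y m) -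
     bin_trunc p q (q - L) h T (X m) (Y' m))| <= h.+1%:Z.
Proof.
move=> pp h0 ph qh hqE bnd HX HY HY'.
have hp : (4 * h < p)%N.
  by apply: leq_ltn_trans ph; rewrite leq_mul2l /= !expnS expn0; nia.
have Yi : injective (fun m : 'I_p => Y m).
  move=> m m' /= E; apply: val_inj; have H := HY m' (ltn_ord m'); rewrite -E in H.
  by apply: (residue_inj (h := h) pp _ _ _ (HY m (ltn_ord m)) H); rewrite ?ltn_ord //; lia.
have Y'i : injective (fun m : 'I_p => Y' m).
  move=> m m' /= E; apply: val_inj; have := HY' m' (ltn_ord m').
  have := HY' m (ltn_ord m); rewrite -E ![c - _ - q%:Z]addrAC => H1 H2.
  by apply: (residue_inj (h := h) pp _ _ _ H1 H2); rewrite ?ltn_ord //; lia.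
(* Since h q = 1 modulo p, lowering t by q lowers y = h^2 t by h. *)
have YY' m : (m < p)%N -> Y m = (Y' m + h)%N \/ (Y m + p = Y' m + h)%N.
  move=> mp; have [Xm Ym Y'm] := bnd m mp.
  have : (p %| (Y m)%:Z - (Y' m)%:Z - h%:Z)%Z.
    have -> : (Y m)%:Z - (Y' m)%:Z - h%:Z =
      ((Y m)%:Z - h%:Z ^+ 2 * (c - m%:Z)) - ((Y' m)%:Z - h%:Z ^+ 2 * (c - m%:Z - q%:Z))
       + (h%:Z * (h%:Z * q%:Z) - h%:Z) by ring.
    have hq1 : (p %| h%:Z * (h%:Z * q%:Z) - h%:Z)%Z.
      have -> : h%:Z * q%:Z = L%:Z * p%:Z + 1 by lia.
      by apply/dvdzP; exists (h%:Z * L%:Z); ring.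
    by apply: rpredD => //; apply: rpredB; [exact: HY|exact: HY'].
  case/dvdzP=> k kE; have : k = 0 \/ k = -1 by nia.
  by case=> k0; rewrite k0 in kE; [left|right]; lia.
have spaced (y : nat -> nat) : (forall m m', (m < p)%N -> (m' < p)%N ->
      (p %| (y m)%:Z - (y m')%:Z - h%:Z ^+ 2 * (m'%:Z - m%:Z))%Z) ->
    forall m m' : 'I_p, (q - L <= X m)%N -> (q - L <= X m')%N ->
    `|(y m)%:Z - (y m')%:Z| < 2 * h%:Z -> m = m'.
  move=> Hy m m' Xm Xm' lt2h; have [m_p m'_p] := (ltn_ord m, ltn_ord m').
  have [[Xmq _ _] [Xmq' _ _]] := (bnd m m_p, bnd m' m'_p).
  have := @hits_spaced h L p q (X m) (X m') (c - m%:Z) (c - m'%:Z)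
     ((y m)%:Z - (y m')%:Z) pp h0 ph qh hqE.
  rewrite Xm Xm' Xmq Xmq' HX // HX // => /(_ isT isT isT isT) W.
  apply: val_inj => /=; suff : c - m%:Z = c - m'%:Z by lia.
  apply: W => //; last lia.
  have -> : c - m%:Z - (c - m'%:Z) = m'%:Z - m%:Z by ring.
  exact: Hy.
have {}spacedY : forall m m' : 'I_p, (q - L <= X m)%N -> (q - L <= X m')%N ->
    `|(Y m)%:Z - (Y m')%:Z| < 2 * h%:Z -> m = m'.
  apply: spaced => m m' mp m'p.
  have -> : (Y m)%:Z - (Y m')%:Z - h%:Z ^+ 2 * (m'%:Z - m%:Z) =
    ((Y m)%:Z - h%:Z ^+ 2 * (c - m%:Z)) - ((Y m')%:Z - h%:Z ^+ 2 * (c - m'%:Z)) by ring.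
  by apply: rpredB; exact: HY.
have {spaced} spacedY' : forall m m' : 'I_p, (q - L <= X m)%N -> (q - L <= X m')%N ->
    `|(Y' m)%:Z - (Y' m')%:Z| < 2 * h%:Z -> m = m'.
  apply: spaced => m m' mp m'p.
  have -> : (Y' m)%:Z - (Y' m')%:Z - h%:Z ^+ 2 * (m'%:Z - m%:Z) =
    ((Y' m)%:Z - h%:Z ^+ 2 * (c - m%:Z - q%:Z)) -
    ((Y' m')%:Z - h%:Z ^+ 2 * (c - m'%:Z - q%:Z)) by ring.
  by apply: rpredB; exact: HY'.
pose P y m := [&& X m < q - L, y < h & X m * p + y * q <= T]%N.
pose B y m := [&& q - L <= X m, h <= y & X m * p + y * q <= T + p * q]%N.
have -> : \sum_(m < p) (bin_trunc p q (q - L) h T (X m) (Y m) -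
     bin_trunc p q (q - L) h T (X m) (Y' m)) =
   (\sum_(m < p) (P (Y m) m)%:R - \sum_(m < p) (P (Y' m) m)%:R)
   + \sum_(m < p) ((B (Y' m) m)%:R - (B (Y m) m)%:R).
  by rewrite -sumrB -big_split; apply: eq_bigr => m _; rewrite !bin_truncE /P /B /=; ring.
have PY : 0 <= (\sum_(m < p) (P (Y m) m)%:R : int) /\ (\sum_(m < p) (P (Y m) m)%:R : int) <= h%:Z.
  split; first exact: sumr_ge0.
  rewrite -[h%:Z]natz; apply: (sum_bool_le_inj (b := fun m => P (Y m) m) Yi) => m; by case/and3P.
have PY' : 0 <= (\sum_(m < p) (P (Y' m) m)%:R : int) /\ (\sum_(m < p) (P (Y' m) m)%:R : int) <= h%:Z.
  split; first exact: sumr_ge0.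
  rewrite -[h%:Z]natz; apply: (sum_bool_le_inj (b := fun m => P (Y' m) m) Y'i) => m; by case/and3P.
have b1 (u v : bool) : u%:R - v%:R <= 1 :> int by case: u; case: v.
have b0 (u v : bool) : 0 < u%:R - v%:R :> int -> u /\ ~~ v by case: u; case: v.
(* A negative term kept for [Y'] but lost for [Y] has [Y'] within h of T / q, or at least p - h
   because of the wrap. Any two such values differ by less than 2 h, so [hits_spaced] leaves one
   index. *)
have BB' : \sum_(m < p) ((B (Y' m) m)%:R - (B (Y m) m)%:R) <= 1 :> int.
  pose Q (m : 'I_p) := [/\ (q - L <= X m)%N, (Y' m * q < T + h * q)%N &
    (T < (Y' m + h) * q)%N \/ (p <= Y' m + h)%N].
  apply: (sum_le1_uniq (Q := Q)) => // [m /b0[]|m m' [Xm H1 H2] [Xm' H1' H2']].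
    rewrite /B => /and3P[Xm Y'm le1]; rewrite Xm /= => nB.
    have [Xmq Ym Y'mp] := bnd m (ltn_ord m).
    have Lp : (p * q <= X m * p + L * p)%N by rewrite -mulnDl mulnC leq_mul2r; lia.
    split => //; first by lia.
    case: (YY' m (ltn_ord m)) => YE; [left|right; lia].
    move: nB; rewrite YE negb_and -!ltnNge mulnDl.
    have : (X m * p < q * p)%N by rewrite ltn_mul2r Xmq andbT; lia.
    by rewrite [(q * p)%N]mulnC; lia.
  apply: spacedY' => //.
  have q0 : (0 < q)%N by lia.
  have [_ _ Y'mp] := bnd m (ltn_ord m); have [_ _ Y'mp'] := bnd m' (ltn_ord m').
  have W a b : (a * q < T + h * q)%N -> (T < (b + h) * q)%N -> (a < b + 2 * h)%N.
    by move=> A1 A2; rewrite -(ltn_pmul2r q0); lia.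
  by case: H2 H2' => A [] A'; first [have := W _ _ H1 A'| idtac];
    first [have := W _ _ H1' A|idtac]; lia.
(* In the other direction, passing from [Y] to [Y'] lowers the exponent and cannot violate the
   truncation; the term is lost only when [Y'] < h, that is h <= [Y] < 2 h. *)
have B'B : \sum_(m < p) ((B (Y m) m)%:R - (B (Y' m) m)%:R) <= 1 :> int.
  pose Q (m : 'I_p) := [/\ (q - L <= X m)%N & (h <= Y m < 2 * h)%N].
  apply: (sum_le1_uniq (Q := Q)) => // [m /b0[]|m m' [Xm H1] [Xm' H1']].
    rewrite /B => /and3P[Xm Ym le1]; rewrite Xm /= => nB; split => //.
    rewrite Ym ltnNge; apply/negP => Y2; move/negP: nB; apply.
    have [|YE] := YY' m (ltn_ord m); last by have [] := bnd m (ltn_ord m); lia.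
    move=> YE; rewrite YE mulnDl in le1; rewrite YE in Y2; lia.
  by apply: spacedY => //; lia.
have fin (a a' e : int) : 0 <= a /\ a <= h%:Z -> 0 <= a' /\ a' <= h%:Z ->
  e <= 1 -> - e <= 1 -> `|a - a' + e| <= h.+1%:Z by lia.
by apply: fin; rewrite // -sumrN; under eq_bigr do rewrite opprB.
Qed.

(** * The window of indices that gives a coefficient at least h *)

Section Window.
Variables (h L p q X y : nat) (t : int).
Hypotheses (h0 : (0 < h)%N) (ph : (4 * h.+1 ^ 3 < p)%N) (hqE : (h * q = L * p + 1)%N).
Hypotheses (Xq : (X < q)%N) (q0 : (0 < q)%N).
Hypothesis HX : (q %| X%:Z * p - h%:Z * (h%:Z + 1) * t)%Z.
Hypothesis HY : (p %| y%:Z - h%:Z ^+ 2 * t)%Z.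
Let U : int := h%:Z * (h%:Z + 1) * t.
Hypothesis U_ge : (h%:Z * h%:Z - 1) * q%:Z <= U.
Hypothesis U_lt : U < h%:Z * h%:Z * q%:Z.

Let hqZ : h%:Z * q%:Z = L%:Z * p%:Z + 1. Proof. lia. Qed.
Let h1 : 1 <= h%:Z. Proof. lia. Qed.
Let pZ : 4 * (h%:Z + 1) * (h%:Z + 1) * (h%:Z + 1) < p%:Z.
Proof.
have : (4 * h.+1 * h.+1 * h.+1 < p)%N by move: ph; rewrite !expnS expn0 muln1 !mulnA.
lia.
Qed.

(** Both sides agree modulo q by [HX]. Modulo p the right side is h (h + 1) t - (h + 1) h^2 t q,
    which vanishes because h q = 1. The size of each term will later determine a. *)
Lemma window_lift : exists a : int,
  X%:Z * p%:Z = U - (h%:Z + 1) * y%:Z * q%:Z + a * (p%:Z * q%:Z).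
Proof.
have /dvdzP[b bE] := HX; have /dvdzP[c cE] := HY.
have yE : y%:Z = c * p%:Z + h%:Z ^+ 2 * t by rewrite -cE; ring.
pose k := X%:Z + (h%:Z + 1) * (c * q%:Z + h%:Z * t * L%:Z).
have qb : q%:Z * (b + (h%:Z + 1) * y%:Z) = p%:Z * k.
  transitivity (b * q%:Z + (h%:Z + 1) * (c * p%:Z * q%:Z + h%:Z * t * (h%:Z * q%:Z))).
    by rewrite yE; ring.
  by rewrite -bE hqZ /k; ring.
exists (h%:Z * k - L%:Z * (b + (h%:Z + 1) * y%:Z)).
have -> : (h%:Z * k - L%:Z * (b + (h%:Z + 1) * y%:Z)) * (p%:Z * q%:Z) =
    q%:Z * (h%:Z * (p%:Z * k) - (L%:Z * p%:Z) * (b + (h%:Z + 1) * y%:Z)) by ring.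
rewrite -qb; have -> : L%:Z * p%:Z = h%:Z * q%:Z - 1 by rewrite hqZ; ring.
transitivity (b * q%:Z + U); first by rewrite -bE /U; ring.
by ring.
Qed.

Let Xp_lt : X%:Z * p%:Z < p%:Z * q%:Z.
Proof. by rewrite mulrC ltr_pM2l //; lia. Qed.

(** For y < h the number U - (h + 1) y q already lies in [0, h^2 q), so a = 0 and X p + y q = U - h
    y q. *)
Lemma window_plus : (y < h)%N -> (X < q - L)%N /\ (X * p + y * q <= h * h * q)%N.
Proof.
move=> yh; have [a aE] := window_lift.
have yq : y%:Z * q%:Z <= (h%:Z - 1) * q%:Z by rewrite ler_wpM2r //; lia.
have gyq : (h%:Z + 1) * y%:Z * q%:Z <= (h%:Z * h%:Z - 1) * q%:Z.
  have -> : (h%:Z * h%:Z - 1) * q%:Z = (h%:Z + 1) * ((h%:Z - 1) * q%:Z) by ring.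
  by rewrite -mulrA ler_wpM2l //; lia.
have gyq0 : 0 <= (h%:Z + 1) * y%:Z * q%:Z by rewrite !mulr_ge0 //; lia.
have hpq : (h%:Z * h%:Z + h%:Z) * q%:Z <= p%:Z * q%:Z.
  by rewrite ler_wpM2r //; apply: le_trans (ltW pZ); clear -h1; nia.
have a0 : a = 0.
  have : a * (p%:Z * q%:Z) < 1 * (p%:Z * q%:Z) by lia.
  have : (- 1) * (p%:Z * q%:Z) < a * (p%:Z * q%:Z) by lia.
  by rewrite !ltr_pM2r; lia.
rewrite a0 mul0r addr0 in aE.
have hyq : h%:Z * y%:Z * q%:Z >= 0 by rewrite !mulr_ge0 //; lia.
split; last by lia.
rewrite -(ltn_pmul2r (_ : 0 < p)%N) ?mulnBl; lia.
Qed.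

(** A surviving negative term would have y < h^2 + h and then a = 1. But X p > p q - h q gives (h +
    1) y q < U + h q < h (h + 1) q, against y >= h. *)
Lemma window_minus : (h <= y)%N ->
  ~~ [&& q - L <= X & X * p + y * q <= h * h * q + p * q]%N.
Proof.
move=> hy; apply/negP => /andP[LX le1]; have [a aE] := window_lift.
have XpL : p%:Z * q%:Z - h%:Z * q%:Z + 1 <= X%:Z * p%:Z.
  have : ((q - L) * p <= X * p)%N by rewrite leq_mul2r LX orbT.
  by rewrite mulnBl; lia.
have y_lt : y%:Z < h%:Z * h%:Z + h%:Z.
  have q0' : 0 < q%:Z by lia.
  by rewrite -(ltr_pM2r q0'); lia.
have gy1 : (h%:Z + 1) * h%:Z * q%:Z <= (h%:Z + 1) * y%:Z * q%:Z.
  by rewrite -!mulrA ler_wpM2l ?ler_wpM2r //; lia.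
have gy2 : (h%:Z + 1) * y%:Z * q%:Z <= p%:Z * q%:Z.
  rewrite ler_wpM2r // (le_trans _ (ltW pZ)) //.
  apply: (@le_trans _ _ ((h%:Z + 1) * (h%:Z * h%:Z + h%:Z))); first by rewrite ler_wpM2l //; lia.
  clear -h1; nia.
have U0 : 0 <= U by apply: le_trans U_ge; rewrite mulr_ge0 //; clear -h1; nia.
have hq0 : 0 <= h%:Z * q%:Z by rewrite mulr_ge0.
have pq0 : 0 < p%:Z * q%:Z by rewrite mulr_gt0 //; lia.
have a1 : a = 1.
  have : a * (p%:Z * q%:Z) < 2 * (p%:Z * q%:Z) by lia.
  have : 0 * (p%:Z * q%:Z) < a * (p%:Z * q%:Z) by lia.
  by rewrite !ltr_pM2r // => ? ?; lia.
by rewrite a1 in aE; lia.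
Qed.

(** Here (h + 1) y q >= h (h + 1) q > U forces a >= 1, and since p is large compared with h^2, the
    resulting X p + y' q exceeds h^2 q. *)
Lemma window_shift (y' : nat) : y = (y' + h)%N -> (y' < h)%N ->
  ~~ (X * p + y' * q <= h * h * q)%N.
Proof.
move=> yE y'h; apply/negP => le1; have [a aE] := window_lift.
rewrite yE PoszD in aE.
have gy1 : (h%:Z + 1) * h%:Z * q%:Z <= (h%:Z + 1) * (y'%:Z + h%:Z) * q%:Z.
  by rewrite -!mulrA ler_wpM2l ?ler_wpM2r //; lia.
have gy2 : (h%:Z + 1) * (y'%:Z + h%:Z) * q%:Z <= (h%:Z + 1) * (2 * h%:Z - 1) * q%:Z.
  by rewrite -!mulrA ler_wpM2l ?ler_wpM2r //; lia.
have gy3 : ((h%:Z + 1) * (2 * h%:Z - 1) + 2) * q%:Z <= p%:Z * q%:Z.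
  rewrite ler_wpM2r // (le_trans _ (ltW pZ)) //; clear -h1; nia.
have pq0 : 0 < p%:Z * q%:Z by rewrite mulr_gt0 //; lia.
have Xp0 : 0 <= X%:Z * p%:Z by rewrite mulr_ge0.
have hq0 : 0 <= h%:Z * q%:Z by rewrite mulr_ge0.
have a1 : 1 <= a.
  have : 0 * (p%:Z * q%:Z) < a * (p%:Z * q%:Z) by lia.
  by rewrite ltr_pM2r // => ?; lia.
have : 1 * (p%:Z * q%:Z) <= a * (p%:Z * q%:Z) by rewrite ler_pM2r.
lia.
Qed.
End Window.

Lemma sum_lt_inj (n h : nat) (f : 'I_n -> nat) : (h <= n)%N -> injective f ->
  (forall m, (f m < n)%N) -> \sum_m (f m < h)%N%:R = h%:R :> int.
Proof.
move=> hn f_inj fn; pose g m : 'I_n := Ordinal (fn m).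
have g_inj : injective g by move=> m m' /(congr1 val) /= /f_inj.
transitivity (\sum_(m < n) (m < h)%N%:R : int).
  by rewrite [RHS](reindex_inj g_inj).
rewrite -[in RHS](card_ord h) -sum1_card natr_sum (big_ord_widen n (fun=> 1 : int)) //.
by rewrite [RHS]big_mkcond; apply: eq_bigr => m _; case: ltnP.
Qed.

(* The window starts just above (h - 1) q / h and the exponents are truncated at
   h^2 q: it then contains all h positive terms of Phi_pq(x^r), no negative term,
   and no positive term of the copy shifted by q. *)
Lemma coef_lower (h L p q : nat) (X Y Y' : nat -> nat) :
  prime p -> (0 < h)%N -> (4 * h.+1 ^ 3 < p)%N -> (h * h.+1 * p < q)%N ->
  (h * q = L * p + 1)%N ->
  let c := (q - q %/ h + p - 1)%N%:Z in
  (forall m, (m < p)%N -> [/\ (X m < q)%N, (Y m < p)%N & (Y' m < p)%N]) ->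
  (forall m, (m < p)%N -> (q %| (X m)%:Z * p - h%:Z * (h%:Z + 1) * (c - m%:Z))%Z) ->
  (forall m, (m < p)%N -> (p %| (Y m)%:Z - h%:Z ^+ 2 * (c - m%:Z))%Z) ->
  (forall m, (m < p)%N -> Y m = (Y' m + h)%N \/ (Y m + p = Y' m + h)%N) ->
  h%:Z <= \sum_(m < p) (bin_trunc p q (q - L) h (h * h * q) (X m) (Y m) -
     bin_trunc p q (q - L) h (h * h * q) (X m) (Y' m)).
Proof.
move=> pp h0 ph qh hqE c bnd HX HY YY'.
have hp : (4 * h < p)%N.
  by apply: leq_ltn_trans ph; rewrite leq_mul2l /= !expnS expn0; nia.
have q0 : (0 < q)%N by lia.
have Yi : injective (fun m : 'I_p => Y m).
  move=> m m' /= E; apply: val_inj; have H := HY m' (ltn_ord m'); rewrite -E in H.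
  by apply: (residue_inj (h := h) pp _ _ _ (HY m (ltn_ord m)) H); rewrite ?ltn_ord //; lia.
rewrite -[h%:Z]natz -(sum_lt_inj _ Yi); [|lia|by move=> m; have [] := bnd m (ltn_ord m)].
apply: ler_sum => m _; have mp := ltn_ord m; have [Xm Ym Y'm] := bnd m mp.
have hdiv : (h * (q %/ h) <= q)%N by rewrite mulnC leq_trunc_div.
have hdiv2 : (q < h * (q %/ h) + h)%N.
  by rewrite {1}(divn_eq q h) mulnC ltn_add2l ltn_mod.
have divq : (q %/ h <= q)%N by exact: leq_div.
(* As m varies, t = c - m runs through the p integers from q - q %/ h on, so h t starts at (h - 1) q
   at least and exceeds it by less than h p. Multiplying by h + 1, with h (h + 1) p < q, puts U in
   the window. *)
have cE : c - m%:Z = q%:Z - (q %/ h)%N%:Z + (p%:Z - 1 - m%:Z) by rewrite /c; lia.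
have ht1 : (h%:Z - 1) * q%:Z <= h%:Z * (c - m%:Z).
  have : 0 <= h%:Z * (p%:Z - 1 - m%:Z) by rewrite mulr_ge0 //; lia.
  by rewrite cE; lia.
have ht2 : h%:Z * (c - m%:Z) <= (h%:Z - 1) * q%:Z + h%:Z * p%:Z - 1.
  have : h%:Z * (p%:Z - 1 - m%:Z) <= h%:Z * (p%:Z - 1) by rewrite ler_wpM2l //; lia.
  by rewrite cE; lia.
have U_ge : (h%:Z * h%:Z - 1) * q%:Z <= h%:Z * (h%:Z + 1) * (c - m%:Z).
  have : (h%:Z + 1) * ((h%:Z - 1) * q%:Z) <= (h%:Z + 1) * (h%:Z * (c - m%:Z)).
    by rewrite ler_wpM2l //; lia.
  lia.
have U_lt : h%:Z * (h%:Z + 1) * (c - m%:Z) < h%:Z * h%:Z * q%:Z.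
  have : (h%:Z + 1) * (h%:Z * (c - m%:Z)) <=
      (h%:Z + 1) * ((h%:Z - 1) * q%:Z + h%:Z * p%:Z - 1).
    by rewrite ler_wpM2l //; lia.
  lia.
have plus := window_plus h0 ph hqE Xm q0 (HX m mp) (HY m mp) U_ge U_lt.
have minus := window_minus h0 ph hqE Xm q0 (HX m mp) (HY m mp) U_ge U_lt.
have shift := window_shift h0 ph hqE Xm q0 (HX m mp) (HY m mp) U_ge U_lt.
rewrite !bin_truncE.
have -> : [&& X m < q - L, Y' m < h & X m * p + Y' m * q <= h * h * q]%N = false.
  apply/negbTE/negP => /and3P[_ y'h]; apply/negP; apply: shift => //.
  by case: (YY' m mp) => //; lia.
have -> : [&& X m < q - L, Y m < h & X m * p + Y m * q <= h * h * q]%N = (Y m < h)%N.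
  by case: (ltnP (Y m) h) => yh; rewrite ?andbF //=; have [-> ->] := plus yh.
have -> : [&& q - L <= X m, h <= Y m & X m * p + Y m * q <= h * h * q + p * q]%N = false.
  case: (leqP h (Y m)) => hy; rewrite ?andbF //=; exact/negbTE/minus.
by rewrite subr0 sub0r opprK lerDl.
Qed.

(** * The height of Phi_pqr *)

Lemma ternary_coords (h L p q r n : nat) : prime p -> prime q -> prime r ->
  p <> q -> (p * q < r)%N -> (0 < h < p)%N -> (h * q = L * p + 1)%N ->
  (r * h = 1 %[mod p])%N -> (r * (h * h.+1) = 1 %[mod q])%N ->
  exists X Y Y' : nat -> nat, forall m, (m < p)%N ->
  [/\ [/\ (X m < q)%N, (Y m < p)%N & (Y' m < p)%N],
      [/\ (r * (X m * p + Y m * q) + m = n %[mod p * q])%N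
       &  (r * (X m * p + Y' m * q) + m + q = n %[mod p * q])%N],
      (q %| (X m)%:Z * p - h%:Z * (h%:Z + 1) * (n%:Z - m%:Z))%Z,
      (p %| (Y m)%:Z - h%:Z ^+ 2 * (n%:Z - m%:Z))%Z &
      (p %| (Y' m)%:Z - h%:Z ^+ 2 * (n%:Z - m%:Z - q%:Z))%Z /\
      (Y m = (Y' m + h)%N \/ (Y m + p = Y' m + h)%N)].
Proof.
move=> pp pq pr npq pqr hp hqE rp rq.
have [p0 q0] := (prime_gt0 pp, prime_gt0 pq).
have cpq : coprime p q by rewrite prime_coprime // dvdn_prime2 //; apply/eqP.
have cr : coprime r (p * q).
  have q1 := prime_gt1 pq; have p1 := prime_gt1 pp.
  by rewrite coprimeMr !prime_coprime // !dvdn_prime2 //; apply/andP; split; apply/eqP; nia.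
have pq0 : (0 < p * q)%N by rewrite muln_gt0 p0.
have /choice[f fP] : forall m, exists u : nat * nat * nat, (m < p)%N ->
  [/\ [/\ (u.1.1 < q)%N, (u.1.2 < p)%N & (u.2 < p)%N],
      [/\ (r * (u.1.1 * p + u.1.2 * q) + m = n %[mod p * q])%N
       &  (r * (u.1.1 * p + u.2 * q) + m + q = n %[mod p * q])%N],
      (q %| u.1.1%:Z * p - h%:Z * (h%:Z + 1) * (n%:Z - m%:Z))%Z,
      (p %| u.1.2%:Z - h%:Z ^+ 2 * (n%:Z - m%:Z))%Z &
      (p %| u.2%:Z - h%:Z ^+ 2 * (n%:Z - m%:Z - q%:Z))%Z /\
      (u.1.2 = (u.2 + h)%N \/ (u.1.2 + p = u.2 + h)%N)].
  move=> m; have [mp|] := ltnP m p; last by exists (0, 0, 0)%N.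
  (* The term p q keeps the natural subtraction of m exact and disappears modulo p q. *)
  have [x [y [xq yp E]]] := crt_surj (n + p * q - m)%N pq0 cpq cr.
  have [y' y'p y'E] : exists2 y', (y' < p)%N & y = (y' + h)%N \/ (y + p = y' + h)%N.
    clear -yp hp; have [hy|yh] := leqP h y; [exists (y - h)%N|exists (y + p - h)%N]; lia.
  have mpq : (m <= p * q)%N by rewrite (leq_trans (ltnW mp)) ?leq_pmulr.
  have E1 : (r * (x * p + y * q) + m = n %[mod p * q])%N.
    by rewrite -modnDml E modnDml subnK ?modnDr // (leq_trans mpq) ?leq_addl.
  have E2 : (r * (x * p + y' * q) + m + q = n %[mod p * q])%N.
    (* As r h = 1 modulo p, lowering y by h removes exactly q from r (x p + y q) modulo p q. *)
    have rhq : (r * h * q = q %[mod p * q])%N.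
      by rewrite -muln_modl rp muln_modl mul1n.
    rewrite -modnDmr -rhq modnDmr; case: y'E => y'E.
      by rewrite -E1 y'E; congr (_ %% _)%N; ring.
    rewrite -E1 -[RHS](modnMDl r); congr (_ %% _)%N.
    transitivity (r * x * p + r * q * (y' + h) + m)%N; first by ring.
    by rewrite -y'E; ring.
  exists (x, y, y') => _ /=.
  have D1 : ((p * q)%N %| (r * (x * p + y * q))%N%:Z - (n%:Z - m%:Z))%Z.
    by have := modn_dvdz E1; rewrite PoszD opprB addrA.
  have D2 : ((p * q)%N %| (r * (x * p + y' * q))%N%:Z - (n%:Z - m%:Z - q%:Z))%Z.
    have := modn_dvdz E2; rewrite !(PoszD _ q) (PoszD _ m); congr (_ %| _)%Z.
    by ring.
  have [HX HY] := crt_coords hqE rp rq D1.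
  have [_ HY'] := crt_coords hqE rp rq D2.
  by split.
by exists (fun m => (f m).1.1), (fun m => (f m).1.2), (fun m => (f m).2).
Qed.

Lemma height_ternary (h p q r : nat) : prime p -> prime q -> prime r ->
  (0 < h)%N -> (4 * h.+1 ^ 3 < p)%N -> (h * h.+1 * p < q)%N -> (p * q < r)%N ->
  (h * q = 1 %[mod p])%N -> (r * h = 1 %[mod p])%N -> (r * (h * h.+1) = 1 %[mod q])%N ->
  height (p * q * r) = h \/ height (p * q * r) = h.+1.
Proof.
move=> pp pq pr h0 ph qh pqr hq1 rp rq; have p1 := prime_gt1 pp.
have hp : (h < p)%N.
  by apply: leq_trans ph; rewrite ltnS (leq_trans (leqnSn h)) // (leq_trans _ (leq_pmull _ _)) // -{1}[h.+1]expn1 leq_exp2l.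
have pq_lt : (p < q)%N by apply: leq_ltn_trans qh; rewrite leq_pmull // muln_gt0 h0.
have npq : p <> q by lia.
have [L hqE] : exists L, (h * q = L * p + 1)%N.
  by exists ((h * q) %/ p)%N; rewrite {1}(divn_eq (h * q) p) hq1 modn_small.
have Lq : (L <= q)%N.
  have : (L * p < q * p)%N.
    by rewrite -ltnS -[(L * p).+1]addn1 -hqE ltnS mulnC leq_mul2l (ltnW hp) orbT.
  by rewrite ltn_mul2r => /andP[_ /ltnW].
have coefE n := ternary_coords n pp pq pr npq pqr (introT andP (conj h0 hp)) hqE rp rq.
have upper n : (absz ('Phi_(p * q * r)`_n)%R <= h.+1)%N.
  have [X [Y [Y' XYP]]] := coefE n.
  rewrite -lez_nat abszE (coef_Phi_pqr (X := X) (Y := Y) (Y' := Y') pp pq pr npq pqr hqE (ltnW hp) Lq).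
    apply: (@coef_upper h L p q _ n%:Z) => // m mp; by have [[]? ? ? _ ? ? []] := XYP m mp.
  by move=> m mp; have [[]? ? ? [] ? ? _ _ _] := XYP m mp.
have le_h : (height (p * q * r) <= h.+1)%N by apply/bigmax_leqP => m _; exact: upper.
suff [n n_ge] : exists n, h%:Z <= ('Phi_(p * q * r))`_n.
  (* Beyond the support the coefficient is the default 0, against h >= 1. *)
  have n_size : (n < (totient (p * q * r)).+1)%N.
    rewrite -size_Cyclotomic ltnNge; apply/negP => /(nth_default 0) e0.
    by move: n_ge; rewrite e0; lia.
  have : (h <= height (p * q * r))%N.
    have h_n : (h <= absz ('Phi_(p * q * r)`_n)%R)%N by lia.
    by rewrite /height (bigD1 (Ordinal n_size)) //= leq_max h_n.
  by move: le_h; rewrite leq_eqVlt ltnS => /orP[/eqP->|le1 le2]; [right|left; apply/eqP; rewrite eqn_leq le1].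
pose c := (q - q %/ h + p - 1)%N; pose T := (h * h * q)%N.
have pq0 : (0 < p * q)%N by rewrite muln_gt0 !prime_gt0.
(* The summand (p q - 1) T r acts as -T r modulo p q, so n = c there; the remainder is below p q <
   r, so n / r = T. *)
pose n := (T * r + (c + (p * q - 1) * (T * r)) %% (p * q))%N.
have nT : (n %/ r = T)%N.
  rewrite /n divnMDl ?divn_small ?addn0 ?prime_gt0 //.
  by rewrite (ltn_trans _ pqr) // ltn_pmod.
have nc : (n = c %[mod p * q])%N.
  rewrite /n modnDmr addnCA -[X in (_ + (X + _))%N]mul1n -mulnDl subnKC //.
  by rewrite addnC [(p * q * _)%N]mulnC modnMDl.
have [X [Y [Y' XYP]]] := coefE c; exists n.
rewrite (coef_Phi_pqr (X := X) (Y := Y) (Y' := Y') pp pq pr npq pqr hqE (ltnW hp) Lq).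
  by rewrite nT; apply: coef_lower => // m mp; have [[]? ? ? _ HX HY []] := XYP m mp.
by move=> m mp; have [[]? ? ? [] ? ? _ _ _] := XYP m mp; split; rewrite ?nc.
Qed.

(** * Divisor sums, the von Mangoldt function and Mertens' estimate *)

(** Splits off the full power of one prime at a time: the induction suited to multiplicative
    functions. *)
Lemma nat_primeM_ind (P : nat -> Prop) : P 1%N ->
  (forall p a m, prime p -> (0 < a)%N -> (0 < m)%N -> ~~ (p %| m)%N -> P m ->
    P (p ^ a * m)%N) ->
  forall n, (0 < n)%N -> P n.
Proof.
move=> P1 PM; elim/ltn_ind => n IHn n0; have [n1|n1] := leqP n 1.
  by have -> : n = 1%N by apply/eqP; rewrite eqn_leq n1.
have pp := pdiv_prime n1; have [m pNm nE] := pfactor_coprime pp n0.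
have a0 : (0 < logn (pdiv n) n)%N by rewrite logn_gt0 mem_primes pp n0 pdiv_dvd.
have m0 : (0 < m)%N by case: (m) nE n0 => // ->.
rewrite nE mulnC; apply: PM => //; first by rewrite -prime_coprime.
apply: IHn => //; rewrite [ltnRHS]nE ltn_Pmulr // -{1}(expn0 (pdiv n)) ltn_exp2l //.
exact: prime_gt1.
Qed.

Lemma perm_primesM (p a m : nat) : prime p -> (0 < a)%N -> (0 < m)%N ->
  ~~ (p %| m)%N -> perm_eq (primes (p ^ a * m)) (p :: primes m).
Proof.
move=> pp a0 m0 pNm; apply: uniq_perm; rewrite /= ?primes_uniq ?mem_primes ?(negbTE pNm) ?andbF //.
by move=> q; rewrite primesM ?expn_gt0 ?(prime_gt0 pp) // primesX // primes_prime // !inE.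
Qed.

Section DivisorSums.
Variable V : nmodType.

Lemma sum_divisors_nat (x n : nat) (F : nat -> V) : (0 < n <= x)%N ->
  \sum_(d <- divisors n) F d = \sum_(1 <= d < x.+1 | (d %| n)%N) F d.
Proof.
case/andP=> n0 nx; rewrite -[RHS]big_filter; apply: perm_big; apply: uniq_perm.
- exact: divisors_uniq.
- exact/filter_uniq/iota_uniq.
move=> d; rewrite -dvdn_divisors // mem_filter mem_index_iota ltnS.
case dn: (d %| n)%N => //=; rewrite (dvdn_gt0 n0 dn) /=.
by rewrite (leq_trans (dvdn_leq n0 dn) nx).
Qed.

Lemma sum_multiples (d x : nat) (G : nat -> V) : (0 < d)%N ->
  \sum_(1 <= n < x.+1 | (d %| n)%N) G (n %/ d)%N = \sum_(1 <= m < (x %/ d).+1) G m.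
Proof.
move=> d0; elim: x => [|x IHx]; first by rewrite div0n !big_geq.
rewrite big_mkcond big_nat_recr //= -big_mkcond IHx divnS //; case: (d %| x.+1)%N; last by rewrite addr0.
by rewrite add1n [in RHS]big_nat_recr.
Qed.

Lemma sum_divisors_resum (x : nat) (F : nat -> nat -> V) :
  \sum_(1 <= n < x.+1) \sum_(d <- divisors n) F d (n %/ d)%N =
  \sum_(1 <= d < x.+1) \sum_(1 <= m < (x %/ d).+1) F d m.
Proof.
transitivity (\sum_(1 <= n < x.+1) \sum_(1 <= d < x.+1 | (d %| n)%N) F d (n %/ d)%N).
  by rewrite !big_nat; apply: eq_bigr => n nx; apply: sum_divisors_nat.
rewrite (exchange_big_dep_nat xpredT) //= !big_nat; apply: eq_bigr => d /andP[d0 _].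
by rewrite -(sum_multiples x (F d)).
Qed.

(** Both sides run over the pairs (d, e) with d e dividing n. *)
Lemma sum_divisors_swap (n : nat) (F : nat -> nat -> V) : (0 < n)%N ->
  \sum_(d <- divisors n) \sum_(e <- divisors (n %/ d)%N) F d e =
  \sum_(e <- divisors n) \sum_(d <- divisors (n %/ e)%N) F d e.
Proof.
move=> n0; have inE G : \sum_(d <- divisors n) \sum_(e <- divisors (n %/ d)%N) G d e =
    \sum_(1 <= d < n.+1) \sum_(1 <= e < n.+1 | (d * e %| n)%N) G d e :> V.
  rewrite (sum_divisors_nat (x := n)) ?n0 ?leqnn // big_mkcond !big_nat.
  apply: eq_bigr => d /andP[d0 _]; case: ifP => dn; last first.
    rewrite big_pred0 // => e; apply/negP => /(dvdn_trans (dvdn_mulr e (dvdnn d))).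
    by rewrite dn.
  rewrite (sum_divisors_nat (x := n)) ?leq_div ?divn_gt0 ?(dvdn_leq n0 dn) //.
  by apply: eq_bigl => e; rewrite dvdn_divRL // mulnC.
rewrite !inE (exchange_big_dep_nat xpredT) //=.
by under [RHS]eq_bigr do under eq_bigl do rewrite mulnC.
Qed.
End DivisorSums.

(** * The Moebius function *)

Definition moebius (n : nat) : int :=
  \prod_(p <- primes n) (if logn p n == 1 then -1 else 0).

Lemma moebius_primeM (p a m : nat) : prime p -> (0 < a)%N -> (0 < m)%N ->
  ~~ (p %| m)%N -> moebius (p ^ a * m) = (if a == 1 then -1 else 0) * moebius m.
Proof.
move=> pp a0 m0 pNm; rewrite /moebius (perm_big _ (perm_primesM pp a0 m0 pNm)).
have pa0 : (0 < p ^ a)%N by rewrite expn_gt0 prime_gt0.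
have logp : logn p m = 0%N by rewrite lognE pp m0 (negbTE pNm).
rewrite big_cons lognM // pfactorK // logp addn0; congr (_ * _).
rewrite !big_seq; apply: eq_bigr => q; rewrite mem_primes => /and3P[qp _ qm].
rewrite lognM // lognX logn_prime // (_ : (q == p) = false) ?muln0 //.
by apply: contraNF pNm => /eqP <-.
Qed.

Lemma normr_moebius_le1 n : `|moebius n| <= 1.
Proof.
rewrite /moebius; elim: (primes n) => [|p s IHs]; first by rewrite big_nil.
by rewrite big_cons normrM; case: ifP => _; rewrite ?normr0 ?mul0r // normrN normr1 mul1r.
Qed.

Lemma sum_moebius n : (0 < n)%N -> \sum_(d <- divisors n) moebius d = (n == 1)%:R.
Proof.
move: n; apply: nat_primeM_ind => [|p a m pp a0 m0 pNm _].
  by rewrite (_ : divisors 1 = [:: 1%N]) // big_seq1 /moebius big_nil.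
have pNd d : d \in divisors m -> [/\ (0 < d)%N & ~~ (p %| d)%N].
  rewrite -dvdn_divisors // => dm; split; first exact: dvdn_gt0 dm.
  by apply: contra pNm => /dvdn_trans; apply.
have -> : (p ^ a * m)%N == 1 = false.
  by rewrite muln_eq1 gtn_eqF // -(expn0 p) ltn_exp2l ?prime_gt1.
rewrite big_divisors_primeM //; case: a a0 => // a _.
(* The exponents 0 and 1 of p cancel each other; higher exponents contribute 0. *)
rewrite 2!big_ord_recl /= addrA -[RHS]addr0; congr (_ + _).
  rewrite -big_split /= big_seq big1 // => d /pNd[d0 pNd'].
  by rewrite expn0 mul1n moebius_primeM //= mulN1r subrr.
rewrite big1 // => j _; rewrite big_seq big1 // => d /pNd[d0 pNd'].
by rewrite moebius_primeM //= mul0r.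
Qed.

(** * The von Mangoldt function and the bounds of Chebyshev and Mertens *)

Section Mangoldt.
Variable R : realType.
Implicit Types n m x p : nat.

Lemma posn n : (0 < n)%N -> (n%:R : R) \is Num.pos.
Proof. by move=> n0; rewrite posrE ltr0n. Qed.

Lemma ln_natM m n : (0 < m)%N -> (0 < n)%N ->
  ln ((m * n)%:R : R) = ln (m%:R : R) + ln (n%:R : R).
Proof. by move=> m0 n0; rewrite natrM lnM ?posn. Qed.

Lemma ln_nat_ge0 n : 0 <= ln (n%:R : R).
Proof. by case: n => [|n]; [rewrite ln0|rewrite ln_ge0 // ler1n]. Qed.

Lemma ler_ln_nat m n : (m <= n)%N -> ln (m%:R : R) <= ln (n%:R : R).
Proof.
case: m => [_|m mn]; first by rewrite ln0 // ln_nat_ge0.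
by rewrite ler_ln ?posn ?ler_nat //; apply: leq_trans mn.
Qed.

Lemma ln_nat_le n : ln (n%:R : R) <= n%:R.
Proof. by case: n => [|n]; [rewrite ln0|rewrite ltW // ln_sublinear ?ltr0n]. Qed.

Lemma ln_natS_le n : (0 < n)%N -> ln (n.+1%:R : R) - ln n%:R <= n%:R^-1.
Proof.
move=> n0; rewrite -ln_div ?posn //.
have -> : (n.+1%:R / n%:R : R) = 1 + n%:R^-1.
  by rewrite -natr1 mulrDl divff ?mul1r // pnatr_eq0 -lt0n.
by rewrite le_ln1Dx // (@lt_le_trans _ _ 0) ?ltrN10 // invr_ge0.
Qed.

Lemma ln2_le1 : ln (2%:R : R) <= 1.
Proof. by have := ln_natS_le (n := 1) isT; rewrite ln1 subr0 invr1. Qed.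

Lemma ln_nat_unbounded (K : R) : exists2 n, (0 < n)%N & K < ln n%:R.
Proof.
have := archi_boundP (ltW (expR_gt0 (K : R))); set n := Num.bound _ => Kn.
exists n; first by rewrite -(ltr0n R) (lt_trans (expR_gt0 K)).
by rewrite -[K]expRK ltr_ln ?posrE ?expR_gt0 // (lt_trans (expR_gt0 K)).
Qed.

(** [primes n] lists the distinct prime divisors, so it is a singleton exactly when n is a prime
    power greater than 1. *)
Definition mangoldt n : R := if primes n is [:: p] then ln p%:R else 0.

Lemma mangoldt_ge0 n : 0 <= mangoldt n.
Proof. by rewrite /mangoldt; case: (primes n) => // p [|//]; exact: ln_nat_ge0. Qed.

Lemma mangoldt_primeX p a : prime p -> (0 < a)%N -> mangoldt (p ^ a) = ln p%:R.
Proof. by move=> pp a0; rewrite /mangoldt primesX // primes_prime. Qed.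

Lemma mangoldtP n : mangoldt n != 0 ->
  exists p a, [/\ prime p, (0 < a)%N & n = (p ^ a)%N].
Proof.
rewrite /mangoldt; case pE: (primes n) => [|p [|]]; rewrite ?eqxx // => _.
have : p \in primes n by rewrite pE mem_head.
rewrite mem_primes => /and3P[pp n0 pn]; exists p, (logn p n); split => //.
  by rewrite logn_gt0 mem_primes pp n0.
by rewrite {1}(prod_prime_decomp n0) prime_decompE pE big_seq1.
Qed.

Lemma sum_mangoldt n : (0 < n)%N -> \sum_(d <- divisors n) mangoldt d = ln n%:R.
Proof.
move: n; apply: nat_primeM_ind => [|p a m pp a0 m0 pNm IHm].
  by rewrite (_ : divisors 1 = [:: 1%N]) // big_seq1 ln1.
have pNd d : d \in divisors m -> [/\ (0 < d)%N & ~~ (p %| d)%N].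
  rewrite -dvdn_divisors // => dm; split; first exact: dvdn_gt0 dm.
  by apply: contra pNm => /dvdn_trans; apply.
rewrite big_divisors_primeM // big_ord_recl /=.
under [X in X + _]eq_bigr do rewrite expn0 mul1n.
have pX0 : (0 < p ^ a)%N by rewrite expn_gt0 prime_gt0.
rewrite IHm ln_natM // natrX lnXn ?ltr0n ?prime_gt0 //.
rewrite addrC; congr (_ + _).
transitivity (\sum_(j < a) ln p%:R : R); last by rewrite sumr_const card_ord.
(* Among the divisors p^(j+1) d with d dividing m, only d = 1 gives a prime power. *)
apply: eq_bigr => j _; rewrite (bigD1_seq 1%N) ?divisors_uniq ?divisor1 //=.
rewrite muln1 mangoldt_primeX // big_seq_cond big1 ?addr0 // => d /andP[/pNd[d0 pNd'] d1].
have := perm_size (perm_primesM pp (isT : (0 < j.+1)%N) d0 pNd').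
rewrite /mangoldt; case: (primes (p ^ j.+1 * d)) => [//|q [|//]] /= [] /esym/size0nil/eqP.
by rewrite primes_eq0 ltnS leq_eqVlt (negbTE d1) ltnNge d0.
Qed.

(** Expand ln (n / d) by [sum_mangoldt] and swap: the sum of the Moebius function over the divisors
    of n / e is 0 unless e = n. *)
Lemma mangoldt_moebius n : (0 < n)%N ->
  \sum_(d <- divisors n) (moebius d)%:~R * ln (n %/ d)%:R = mangoldt n.
Proof.
move=> n0.
transitivity (\sum_(d <- divisors n) \sum_(e <- divisors (n %/ d))
    (moebius d)%:~R * mangoldt e).
  rewrite !big_seq; apply: eq_bigr => d; rewrite -dvdn_divisors // => dn.
  by rewrite -mulr_sumr sum_mangoldt // divn_gt0 ?(dvdn_leq n0 dn) ?(dvdn_gt0 n0 dn).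
rewrite sum_divisors_swap // (bigD1_seq n) ?divisors_id ?divisors_uniq //=.
rewrite divnn n0 (_ : divisors 1 = [:: 1%N]) // big_seq1 /moebius big_nil mul1r.
rewrite big_seq_cond big1 ?addr0 // => e /andP[]; rewrite -dvdn_divisors // => en ne.
rewrite -mulr_suml -rmorph_sum sum_moebius ?divn_gt0 ?(dvdn_leq n0 en) ?(dvdn_gt0 n0 en) //.
rewrite (_ : _ == 1 = false) ?mul0r //; apply: contra_neqF ne => /eqP e1.
by rewrite -[RHS](divnK en) e1 mul1n.
Qed.

Lemma mangoldt_le_ln n : mangoldt n <= ln n%:R.
Proof.
case: n => [|n]; first by rewrite /mangoldt ln0.
rewrite -sum_mangoldt // (bigD1_seq n.+1) ?divisors_id ?divisors_uniq //=.
by rewrite lerDl sumr_ge0 // => d _; exact: mangoldt_ge0.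
Qed.

Definition log_fact x : R := \sum_(1 <= n < x.+1) ln n%:R.

(** Legendre's formula in logarithmic form: x %/ m of the integers up to x are multiples of m. *)
Lemma log_fact_mangoldt x :
  log_fact x = \sum_(1 <= m < x.+1) mangoldt m * (x %/ m)%:R.
Proof.
rewrite /log_fact; transitivity
  (\sum_(1 <= n < x.+1) \sum_(d <- divisors n) mangoldt d).
  by rewrite !big_nat; apply: eq_bigr => n /andP[n0 _]; rewrite sum_mangoldt.
rewrite (sum_divisors_resum x (fun d _ => mangoldt d)).
by apply: eq_bigr => d _; rewrite sumr_const_nat subn1 mulr_natr.
Qed.

Lemma log_factS x : log_fact x.+1 = log_fact x + ln x.+1%:R.
Proof. by rewrite /log_fact big_nat_recr. Qed.

Lemma log_fact_le x : log_fact x <= x%:R * ln x%:R.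
Proof.
elim: x => [|x IHx]; first by rewrite /log_fact big_geq // mul0r.
rewrite log_factS -natr1 mulrDl mul1r lerD2r (le_trans IHx) // ler_wpM2l //.
by rewrite natr1 ler_ln_nat.
Qed.

Lemma log_fact_ge x : x%:R * ln x%:R - x%:R <= log_fact x.
Proof.
elim: x => [|x IHx]; first by rewrite /log_fact big_geq // mul0r subrr.
rewrite log_factS; case: x IHx => [|x] IHx.
  by rewrite /log_fact big_geq // ln1; lra.
have x0 : 0 < x.+1%:R :> R by rewrite ltr0n.
have := ln_natS_le (n := x.+1) isT; rewrite -(ler_pM2l x0) divff ?gt_eqF //.
have -> : x.+2%:R = x.+1%:R + 1 :> R by rewrite natr1.
move: IHx; lra.
Qed.

(** The left side is the logarithm of the central binomial coefficient; each induction step adds at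
    most 2 ln 2 <= 2. *)
Lemma log_fact_double n : log_fact (n.*2) - 2 * log_fact n <= n.*2%:R.
Proof.
elim: n => [|n IHn]; first by rewrite /log_fact big_geq // mulr0 subrr.
rewrite doubleS !log_factS.
have le1 := ler_ln_nat (leqnSn n.*2.+1).
have e2 : ln (n.*2.+2%:R : R) = ln 2%:R + ln n.+1%:R.
  by rewrite -ln_natM // mul2n doubleS.
have := ln2_le1; move: le1 IHn; rewrite e2 -!natr1; lra.
Qed.

Definition psi x : R := \sum_(1 <= n < x.+1) mangoldt n.

(** Chebyshev's argument: in the logarithm of the central binomial coefficient, m has weight 2n %/ m
    - 2 (n %/ m) >= 0, which is at least 1 for n < m <= 2n. *)
Lemma psi_double n : psi n.*2 <= psi n + n.*2%:R.
Proof.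
have := log_fact_double n; rewrite /psi.
have split2 F : \sum_(1 <= m < n.*2.+1) F m =
    \sum_(1 <= m < n.+1) F m + \sum_(n.+1 <= m < n.*2.+1) F m :> R.
  by rewrite (big_cat_nat (n := n.+1)) //= ltnS -addnn leq_addr.
rewrite (log_fact_mangoldt n) (log_fact_mangoldt n.*2) !split2 => le1.
have le2 : 2 * (\sum_(1 <= m < n.+1) mangoldt m * (n %/ m)%:R) <=
    \sum_(1 <= m < n.+1) mangoldt m * (n.*2 %/ m)%:R.
  rewrite mulr_sumr ler_sum // => m _; rewrite mulrCA ler_wpM2l ?mangoldt_ge0 //.
  by rewrite -natrM ler_nat -mul2n; case: m => [|m] //; rewrite leq_divRL // -mulnA leq_mul2l leq_trunc_div.
have le3 : \sum_(n.+1 <= m < n.*2.+1) mangoldt m <=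
    \sum_(n.+1 <= m < n.*2.+1) mangoldt m * (n.*2 %/ m)%:R.
  rewrite ler_sum_nat // => m /andP[nm m2n]; rewrite ler_peMr ?mangoldt_ge0 //.
  by rewrite ler1n divn_gt0 // (leq_ltn_trans _ nm).
lra.
Qed.

(** From k to 2k + 1 doubling adds at most 2k and the last term, bounded crudely by its index, at
    most 2k + 1; hence the constant 4. *)
Lemma psi_le x : psi x <= 4 * x%:R.
Proof.
elim/ltn_ind: x => x IHx.
have [x1|x1] := leqP x 1.
  have -> : psi x = 0.
    rewrite /psi; case: x x1 {IHx} => [|[|//]] _; first by rewrite big_geq.
    by rewrite big_nat1.
  by rewrite mulr_ge0.
have psi_half := psi_double x./2; have := IHx x./2; rewrite -[X in (X < _)%N]divn2 ltn_Pdiv ?(ltnW x1) // => /(_ isT) IH.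
have xE := odd_double_half x; have dE : (x./2).*2%:R = 2 * x./2%:R :> R.
  by rewrite -mul2n natrM.
have half1 : 1 <= x./2%:R :> R by rewrite ler1n half_gt0.
case: (odd x) xE => /= xE; last first.
  by rewrite -xE add0n; lra.
rewrite -xE add1n /psi big_nat_recr //= -/(psi _).
have := mangoldt_le_ln (x./2).*2.+1; have := ln_nat_le (x./2).*2.+1.
rewrite -natr1; lra.
Qed.

(** Replacing x / m by its integer part only lowers the sum, and turns x times it into ln (x!). *)
Lemma mertens_ge x : (0 < x)%N ->
  ln x%:R - 1 <= \sum_(1 <= n < x.+1) mangoldt n / n%:R.
Proof.
move=> x0; have x0' : 0 < x%:R :> R by rewrite ltr0n.
rewrite -(ler_pM2l x0') mulrBr mulr1; apply: le_trans (log_fact_ge x) _.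
rewrite log_fact_mangoldt mulr_sumr ler_sum_nat // => m /andP[m0 _].
rewrite mulrCA ler_wpM2l ?mangoldt_ge0 // ler_pdivlMr ?ltr0n //.
by rewrite -natrM ler_nat leq_trunc_div.
Qed.

(** Replacing x / m by x %/ m + 1 costs [psi x] <= 4 x. *)
Lemma mertens_le x : (0 < x)%N ->
  \sum_(1 <= n < x.+1) mangoldt n / n%:R <= ln x%:R + 4.
Proof.
move=> x0; have x0' : 0 < x%:R :> R by rewrite ltr0n.
rewrite -(ler_pM2l x0') mulrDr.
apply: (@le_trans _ _ (log_fact x + psi x)); last first.
  by rewrite lerD ?log_fact_le // mulrC psi_le.
rewrite log_fact_mangoldt /psi -big_split mulr_sumr ler_sum_nat //= => m /andP[m0 _].
rewrite -[X in _ + X]mulr1 -mulrDr mulrCA ler_wpM2l ?mangoldt_ge0 //.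
rewrite ler_pdivrMr ?ltr0n // natr1 -natrM ler_nat.
by rewrite ltnW // ltn_ceil.
Qed.
End Mangoldt.

(** * Prime powers of exponent at least 2 *)

Section PrimePowers.
Variable R : realType.

Lemma sum_expV_le (p : R) (x : nat) : 1 < p ->
  \sum_(2 <= k < x.+1) p ^- k <= (p * (p - 1))^-1.
Proof.
move=> p1; have p0 : 0 < p by lra.
have q0 : 0 < p - 1 by lra.
have pq0 : 0 <= (p * (p - 1))^-1 by rewrite invr_ge0 mulr_ge0 // ltW.
case: x => [|x]; first by rewrite big_geq.
suff -> : \sum_(2 <= k < x.+2) p ^- k = (p * (p - 1))^-1 - p ^- x.+1 / (p - 1).
  by rewrite gerDl oppr_le0 divr_ge0 ?invr_ge0 ?exprn_ge0 // ltW.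
elim: x => [|x IHx]; first by rewrite big_geq // expr1 invfM subrr.
rewrite big_nat_recr //= IHx [p ^+ x.+2]exprS invfM.
have : p ^+ x.+1 != 0 by rewrite expf_neq0 // gt_eqF.
set u := p ^+ x.+1 => u0; field.
by rewrite u0 !gt_eqF.
Qed.

Lemma sum_ln_inv_le (x : nat) :
  \sum_(2 <= p < x.+1) ln (p%:R : R) / (p%:R * (p%:R - 1)) <= 2.
Proof.
case: x => [|x]; first by rewrite big_geq.
(* With a = x + 1, the bound 2 - (ln a + 2) / a increases at each step by at least the new term,
   because ln (a + 1) - ln a <= 1 / a. *)
suff : \sum_(2 <= p < x.+2) ln (p%:R : R) / (p%:R * (p%:R - 1)) <=
    2 - (ln x.+1%:R + 2) / x.+1%:R.
  move/le_trans; apply; rewrite gerDl oppr_le0 divr_ge0 // addr_ge0 //.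
  exact: ln_nat_ge0.
elim: x => [|x IHx]; first by rewrite big_geq // ln1 add0r divr1 subrr.
rewrite big_nat_recr //=; apply: le_trans (lerD IHx (lexx _)) _.
have l1 := ln_natS_le R (n := x.+1) isT; have l0 := ln_nat_ge0 R x.+1.
have -> : x.+2%:R = x.+1%:R + 1 :> R by rewrite natr1.
have -> : x.+1%:R + 1 - 1 = x.+1%:R :> R by rewrite addrK.
move: l1; have -> : x.+2%:R = x.+1%:R + 1 :> R by rewrite natr1.
have : 1 <= x.+1%:R :> R by rewrite ler1n.
move: l0; set a : R := x.+1%:R; set u := ln a; set v := ln (a + 1) => u0 a1 l1.
rewrite -subr_ge0.
have -> : 2 - (v + 2) / (a + 1) - (2 - (u + 2) / a + v / ((a + 1) * a)) =
   (2 - (v - u) * (a + 1)) / (a * (a + 1)) + 0.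
  by rewrite addr0; field; apply/andP; split; rewrite gt_eqF //; lra.
rewrite addr0 divr_ge0 ?mulr_ge0 //; try lra.
rewrite subr_ge0; apply: (@le_trans _ _ (a^-1 * (a + 1))).
  by rewrite ler_wpM2r //; lra.
have -> : a^-1 * (a + 1) = 1 + a^-1 by rewrite mulrDr mulVf ?mulr1 // gt_eqF //; lra.
by rewrite (_ : 2 = 1 + 1) // lerD2l invf_le1 //; lra.
Qed.

(** The nonzero terms sit at p^k with k >= 2; for fixed p they sum to at most ln p / (p (p - 1)). *)
Lemma mangoldt_nonprime_le (x : nat) :
  \sum_(1 <= n < x.+1 | ~~ prime n) mangoldt R n / n%:R <= 2.
Proof.
apply: le_trans (sum_ln_inv_le x).
apply: (@le_trans _ _ (\sum_(1 <= n < x.+1) \sum_(2 <= p < x.+1)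
    \sum_(2 <= k < x.+1) (n == p ^ k)%N%:R * (ln p%:R * p%:R ^- k))).
  rewrite big_mkcond; apply: ler_sum_nat => n /andP[n0 nx].
  have term_ge0 p k : 0 <= (n == p ^ k)%N%:R * (ln (p%:R : R) * p%:R ^- k).
    by rewrite !mulr_ge0 ?ln_nat_ge0 // invr_ge0 exprn_ge0.
  have sum_ge0 : 0 <= \sum_(2 <= p < x.+1) \sum_(2 <= k < x.+1)
      (n == p ^ k)%N%:R * (ln (p%:R : R) * p%:R ^- k).
    by apply: sumr_ge0 => p _; apply: sumr_ge0.
  case: ifP => // npr; have [->|] := eqVneq (mangoldt R n) 0; first by rewrite mul0r.
  case/mangoldtP => p [a [pp a0 nE]].
  have a2 : (2 <= a)%N.
    by case: a a0 nE => [|[|//]] // _ nE; rewrite nE expn1 pp in npr.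
  have pn : (p < x.+1)%N.
    rewrite (leq_ltn_trans _ nx) // nE -{1}(expn1 p) leq_exp2l ?prime_gt1 //.
  have an : (a < x.+1)%N.
    by rewrite (leq_ltn_trans _ nx) // nE ltnW // ltn_expl // prime_gt1.
  rewrite (bigD1_seq p) ?iota_uniq ?mem_index_iota ?prime_gt1 //=.
  rewrite (bigD1_seq a) ?iota_uniq ?mem_index_iota ?a2 //=.
  rewrite nE mangoldt_primeX // eqxx mul1r natrX -addrA lerDl addr_ge0 //.
    by apply: sumr_ge0 => k _; rewrite -nE.
  by apply: sumr_ge0 => q _; apply: sumr_ge0 => k _; rewrite -nE.
rewrite exchange_big /=; apply: ler_sum_nat => p /andP[p2 px].
rewrite exchange_big /=.
apply: (@le_trans _ _ (\sum_(2 <= k < x.+1) ln (p%:R : R) * p%:R ^- k)).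
  apply: ler_sum_nat => k _; rewrite -mulr_suml ler_piMl ?mulr_ge0 ?ln_nat_ge0 ?invr_ge0 ?exprn_ge0 //.
  rewrite -natr_sum -[leRHS]/(1%:R) ler_nat.
  have [pk|pk] := boolP ((p ^ k)%N \in index_iota 1 x.+1); last first.
    rewrite big_seq big1 // => n nin; apply/eqP; rewrite eqb0.
    by apply: contraNN pk => /eqP <-.
  rewrite (bigD1_seq (p ^ k)%N) ?iota_uniq //= eqxx big1 // => n.
  by move=> /negbTE ->.
rewrite -mulr_sumr ler_wpM2l ?ln_nat_ge0 // sum_expV_le //.
by rewrite ltr1n.
Qed.
End PrimePowers.

(** * Dirichlet characters *)

Lemma prim_root_exists (C : numClosedFieldType) (n : nat) : (0 < n)%N ->
  exists z : C, n.-primitive_root z.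
Proof.
move=> n0; have [r Dp] := closed_field_poly_normal ('X^n - 1 : {poly C}).
have monp : lead_coef ('X^n - 1 : {poly C}) = 1 by apply/eqP; rewrite -monicE monicXnsubC.
rewrite monp scale1r in Dp.
have sz : size r = n.
  by have := congr1 (fun p : {poly C} => size p) Dp; rewrite size_XnsubC // size_prod_XsubC => -[].
have ur : uniq r.
  rewrite -separable_prod_XsubC -Dp separable_Xn_sub_1 // pnatr_eq0 -lt0n //.
have : has n.-primitive_root r.
  apply: has_prim_root => //; last by rewrite sz.
  by apply/allP => z zr; rewrite unity_rootE -subr_eq0 -[z ^+ n](hornerXn) -[1](hornerC 1 z)
    -hornerN -hornerD Dp -rootE root_prod_XsubC.
by case/hasP => z _ pz; exists z.
Qed.

Section RootTransfer.
Variables (C : numClosedFieldType) (m : nat) (z : algC) (w : C).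
Hypotheses (pz : m.-primitive_root z) (pw : m.-primitive_root w).

(* Character theory takes values in algC; this moves the values, which are roots
   of unity, to a field C carrying the real numbers. *)
Definition root_transfer (v : algC) : C :=
  if [pick k : 'I_m | v == z ^+ k] is Some k then w ^+ k else 0.

Lemma root_transferX k : root_transfer (z ^+ k) = w ^+ k.
Proof.
rewrite /root_transfer; case: pickP => [j /eqP/eqP|].
  by rewrite (eq_prim_root_expr pz) => /eqP E; apply/eqP; rewrite (eq_prim_root_expr pw) E.
have m0 := prim_order_gt0 pz.
move=> /(_ (Ordinal (ltn_pmod k m0))) /=.
by rewrite (eq_prim_root_expr pz) modn_mod eqxx.
Qed.

Lemma root_transferM u v : u ^+ m = 1 -> v ^+ m = 1 ->
  root_transfer (u * v) = root_transfer u * root_transfer v.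
Proof.
case/(prim_rootP pz) => i -> /(prim_rootP pz) [j ->].
by rewrite -exprD !root_transferX exprD.
Qed.

Lemma root_transfer1 : root_transfer 1 = 1.
Proof. by rewrite -(expr0 z) root_transferX. Qed.

Lemma root_transfer_unity u : u ^+ m = 1 -> root_transfer u ^+ m = 1.
Proof.
by case/(prim_rootP pz) => i ->; rewrite root_transferX exprAC (prim_expr_order pw) expr1n.
Qed.

Lemma root_transfer_eq1 u : u ^+ m = 1 -> (root_transfer u == 1) = (u == 1).
Proof.
case/(prim_rootP pz) => i ->; rewrite root_transferX.
by rewrite -(expr0 w) -(expr0 z) (eq_prim_root_expr pz) (eq_prim_root_expr pw).
Qed.

Lemma root_transferV u : u ^+ m = 1 -> root_transfer u^-1 = (root_transfer u)^-1.
Proof.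
move=> um; have unity_neq0 (F : fieldType) (x : F) : x ^+ m = 1 -> x != 0.
  by apply: contra_eq_neq => ->; rewrite expr0n gtn_eqF ?(prim_order_gt0 pz) // eq_sym oner_neq0.
have [u0 r0] := (unity_neq0 _ _ um, unity_neq0 _ _ (root_transfer_unity um)).
apply: (mulfI r0); rewrite divff // -root_transferM ?exprVn ?um ?invr1 //.
by rewrite divff // root_transfer1.
Qed.
End RootTransfer.

(** The interface between character theory and analysis: [i0] is the principal character, [cj]
    complex conjugation on indices, and [dchar_orth] the orthogonality relation that isolates a
    residue class. *)
Record dirichlet_chars (C : numClosedFieldType) (N : nat) (I : finType)
    (chi : I -> nat -> C) (i0 : I) (cj : I -> I) : Prop := DirichletChars {
  dchar1 : forall i, chi i 1%N = 1;
  dcharM : forall i m n, chi i (m * n)%N = chi i m * chi i n;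
  dchar_mod : forall i n, chi i (n %% N)%N = chi i n;
  dchar0 : forall i n, ~~ coprime n N -> chi i n = 0;
  dchar_norm : forall i n, coprime n N -> `|chi i n| = 1;
  dchar_i0 : forall n, chi i0 n = (coprime n N)%:R;
  dchar_cj : forall i n, chi (cj i) n = (chi i n)^*;
  dchar_cj0 : forall i, i != i0 -> cj i != i0;
  dchar_nontriv : forall i, i != i0 -> exists2 a, coprime a N & chi i a != 1;
  dchar_orth : forall a n, coprime a N ->
    \sum_i (chi i a)^* * chi i n = (#|I| * (n == a %[mod N]))%N%:R }.

Lemma dirichlet_chars_exist (C : numClosedFieldType) (N : nat) : (1 < N)%N ->
  exists (I : finType) (chi : I -> nat -> C) (i0 : I) (cj : I -> I),
    dirichlet_chars N chi i0 cj.
Proof.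
move=> N1; pose G := [set: {unit 'Z_N}]%G.
have abG : abelian G by exact: units_Zp_abelian.
have lin (i : Iirr G) : 'chi_i \is a linear_char by move/char_abelianP: abG; apply.
have inG (u : {unit 'Z_N}) : u \in G by rewrite inE.
have [z pz] := C_prim_root_exists (cardG_gt0 G).
have [w pw] := prim_root_exists C (cardG_gt0 G).
pose T := root_transfer #|G| z w.
have chiX (i : Iirr G) u : 'chi_i u ^+ #|G| = 1.
  by rewrite -(lin_charX (lin i)) ?inG // expg_cardG ?inG // lin_char1.
have T1 : T 1 = 1 by exact: root_transfer1.
have TM u v : u ^+ #|G| = 1 -> v ^+ #|G| = 1 -> T (u * v) = T u * T v.
  exact: root_transferM.
(* The class of n as a unit modulo N, or [None] when n is not coprime to N, where characters take
   the value 0. *)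
pose un (n : nat) : option {unit 'Z_N} := insub (n%:R : 'Z_N).
pose chi (i : Iirr G) (n : nat) : C := if un n is Some u then T ('chi_i u) else 0.
have unP n : coprime n N -> exists2 u, un n = Some u & FinRing.uval u = n%:R.
  rewrite coprime_sym -unitZpE // => Un; exists (FinRing.Unit Un) => //.
  by rewrite /un insubT.
have un0 n : ~~ coprime n N -> un n = None.
  by rewrite coprime_sym -unitZpE // => Un; rewrite /un insubF //; apply: negbTE.
have chi_unity (i : Iirr G) u : T ('chi_i u) ^+ #|G| = 1 by exact: (root_transfer_unity pz pw (chiX i u)).
have orth u : \sum_(i : Iirr G) T ('chi_i u) = (#|{: Iirr G}| * (u == 1%g))%N%:R.
  have [->|u1] := eqVneq u 1%g.
    rewrite muln1; under eq_bigr do rewrite lin_char1 // T1.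
    by rewrite sumr_const.
  rewrite muln0.
  (* The kernels of the irreducible characters intersect trivially, so some character differs from 1
     at u. Multiplication by it permutes the characters, so its value at u fixes the sum, which must
     be 0. *)
  have [j j1] : exists j : Iirr G, 'chi_j u != 1.
    apply/existsP; apply: contraNT u1; rewrite negb_exists => /forallP uker.
    have : u \in (\bigcap_(i : Iirr G) cfker 'chi_i)%SET.
      apply/bigcapP => i _; rewrite cfkerEirr inE lin_char1 //.
      by have := uker i; rewrite negbK.
    by rewrite TI_cfker_irr inE.
  pose f (i : Iirr G) := cfIirr ('chi_j * 'chi_i).
  have fE i : 'chi_(f i) = 'chi_j * 'chi_i by rewrite cfIirrE // mul_lin_irr ?mem_irr.
  have f_inj : injective f.
    move=> i i' /(congr1 (fun k => 'chi_k)); rewrite !fE => E; apply: irr_inj.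
    have := congr1 (fun phi => cfAut Num.Def.conjC 'chi_j * phi) E.
    by rewrite !mulrA ![_ * 'chi_j]mulrC !mul_conjC_lin_char // !mul1r.
  set S := \sum_i _; have : T ('chi_j u) * S = S.
    rewrite [in RHS]/S (reindex_inj f_inj) mulr_sumr; apply: eq_bigr => i _.
    by rewrite fE cfunE TM.
  move/eqP; rewrite -subr_eq0 -[X in _ - X]mul1r -mulrBl mulf_eq0 subr_eq0.
  by rewrite (root_transfer_eq1 pz pw) // (negbTE j1) => /eqP.
have T_neq0 (i : Iirr G) u : T ('chi_i u) != 0.
  by apply: contra_eq_neq (chi_unity i u) => ->; rewrite expr0n gtn_eqF // eq_sym oner_neq0.
have T_norm (i : Iirr G) u : `|T ('chi_i u)| = 1.
  apply/eqP; rewrite -(pexpr_eq1 (n := #|G|)) ?cardG_gt0 // -normrX chi_unity normr1 //.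
have T_conj (i : Iirr G) u : (T ('chi_i u))^* = T ('chi_i u^-1%g).
  rewrite lin_charV ?inG // [RHS](root_transferV pz pw (chiX i u)).
  by apply: (mulfI (T_neq0 i u)); rewrite -normCK T_norm expr1n divff.
exists {: Iirr G}, chi, 0, (@conjC_Iirr _ G).
have un1 : un 1%N = Some 1%g.
  have [u -> uE] := unP 1%N (coprime1n N); congr Some; apply: val_inj => /=.
  by rewrite uE.
split.
- by move=> i; rewrite /chi un1 lin_char1 // T1.
- move=> i a b; rewrite /chi.
  have [cab|cab] := boolP (coprime (a * b) N); last first.
    rewrite (un0 _ cab); move: cab; rewrite coprimeMl negb_and.
    by case/orP => /un0 ->; [rewrite mul0r|case: (un a) => *; rewrite mulr0].
  have := cab; rewrite coprimeMl => /andP[/unP[u -> uE] /unP[v -> vE]].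
  have [x -> xE] := unP _ cab; have -> : x = (u * v)%g.
    by apply: val_inj; rewrite /= xE natrM uE vE.
  by rewrite lin_charM ?inG // TM.
- by move=> i a; rewrite /chi /un Zp_nat_mod.
- by move=> i a /un0; rewrite /chi => ->.
- by move=> i a /unP[u]; rewrite /chi => -> _; exact: T_norm.
- move=> a; rewrite /chi irr0; case: (boolP (coprime a N)) => [/unP[u -> _]|/un0 ->//].
  by rewrite cfun1E inG T1.
- move=> i a; rewrite /chi; case: (un a) => [u|]; last by rewrite conjC0.
  by rewrite conjC_IirrE cfunE T_conj lin_charV_conj ?inG.
- by move=> i; rewrite conjC_Iirr_eq0.
- move=> i i0; have [u ui] : exists u, 'chi_i u != 1.
    apply/existsP; apply: contraNT i0; rewrite negb_exists => /forallP all1.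
    apply/eqP; apply: irr_inj; rewrite irr0; apply/cfunP => u.
    by rewrite cfun1E inG; apply/eqP; have := all1 u; rewrite negbK.
  have cu : coprime (FinRing.uval u) N.
    by rewrite coprime_sym -unitZpE // natr_Zp; exact: (valP u).
  exists (FinRing.uval u : nat) => //; have [v vu vE] := unP _ cu.
  have -> : chi i (FinRing.uval u) = T ('chi_i u).
    rewrite /chi vu; congr (T ('chi_i _)); apply: val_inj => /=.
    by rewrite vE natr_Zp.
  by rewrite (root_transfer_eq1 pz pw).
- move=> a b ca; have [u ua uE] := unP a ca; rewrite /chi ua.
  case: (boolP (coprime b N)) => [/unP[v -> vE]|cb]; last first.
    rewrite un0 // big1 => [|i _]; last by rewrite mulr0.
    rewrite (_ : _ == _ = false) ?muln0 //; apply: contraNF cb => /eqP E.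
    by rewrite -coprime_modl E coprime_modl.
  under eq_bigr => i _ do rewrite T_conj -TM // -lin_charM ?inG //.
  rewrite orth; congr ((_ * nat_of_bool _)%N%:R).
  rewrite -eq_mulVg1 -(inj_eq val_inj) /= uE vE eq_sym -(inj_eq val_inj) /=.
  by rewrite !val_Zp_nat.
Qed.

(** * Character sums *)

Section ComplexNorm.
Variable R : realType.
Local Notation C := R[i].
Local Open Scope complex_scope.

Lemma normc_real (x : R) : normc x%:C = `|x|.
Proof. by rewrite /normc /= expr0n /= addr0 sqrtr_sqr. Qed.

Lemma normc_ge0 (z : C) : 0 <= normc z.
Proof. by case: z => a b; rewrite /normc sqrtr_ge0. Qed.

Lemma normc_ge_re (z : C) : `|complex.Re z| <= normc z.
Proof. by case: z => x y; rewrite /normc -sqrtr_sqr ler_wsqrtr // lerDl sqr_ge0. Qed.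

Lemma normc_ge_im (z : C) : `|complex.Im z| <= normc z.
Proof. by case: z => x y; rewrite /normc -sqrtr_sqr ler_wsqrtr // lerDr sqr_ge0. Qed.

Lemma normc_le_reim (z : C) : normc z <= `|complex.Re z| + `|complex.Im z|.
Proof.
case: z => x y /=; rewrite -[leRHS]ger0_norm ?addr_ge0 // -sqrtr_sqr ler_wsqrtr //.
have := mulr_ge0 (normr_ge0 x) (normr_ge0 y).
by rewrite sqrrD !real_normK ?num_real // -mulr_natr; lra.
Qed.

Lemma normc_sum (I : Type) (r : seq I) (P : pred I) (F : I -> C) :
  normc (\sum_(i <- r | P i) F i) <= \sum_(i <- r | P i) normc (F i).
Proof.
elim/big_ind2: _ => [|x a y b xa yb|//]; first by rewrite normc0.
by apply: le_trans (le_normcD _ _) _; rewrite lerD.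
Qed.

Lemma normcB (x y : C) : normc (x - y) <= normc x + normc y.
Proof. by rewrite -[normc y]normcN le_normcD. Qed.

(** Summation by parts: the differences of the decreasing weight are nonnegative and telescope. *)
Lemma abel_bound (u : nat -> C) (f : nat -> R) (K : R) (a b : nat) :
  (forall m, normc (\sum_(a <= n < m) u n) <= K) ->
  (forall n, (a <= n)%N -> 0 <= f n.+1 <= f n) -> 0 <= f a ->
  normc (\sum_(a <= n < b) u n * (f n)%:C) <= K * f a.
Proof.
move=> uK f_dec fa; have K0 : 0 <= K by apply: le_trans (uK a); exact: normc_ge0.
have [ba|ab] := leqP b a; first by rewrite big_geq // normc0 mulr_ge0.
have -> : \sum_(a <= n < b) u n * (f n)%:C = (\sum_(a <= n < b) u n) * (f b)%:C +
    \sum_(a <= n < b) (\sum_(a <= k < n.+1) u k) * (f n - f n.+1)%:C.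
  elim: b ab => // b IHb; rewrite ltnS leq_eqVlt => /orP[/eqP <-|ab].
    by rewrite !big_nat1 -mulrDr -rmorphD /= addrCA subrr addr0.
  rewrite !(big_nat_recr b) ?(ltnW ab) //= IHb // rmorphB /=; ring.
apply: le_trans (le_normcD _ _) _.
have fb n : (a <= n)%N -> 0 <= f n.
  by rewrite leq_eqVlt => /orP[/eqP <-//|]; case: n => // n an; have /andP[] := f_dec n an.
have -> : K * f a = K * f b + \sum_(a <= n < b) K * (f n - f n.+1).
  rewrite -mulr_sumr -mulrDr; congr (_ * _).
  have := telescope_sumr f (ltnW ab).
  under [in X in _ -> X]eq_bigr do rewrite -opprB.
  by rewrite sumrN => ->; ring.
apply: lerD.
  by rewrite normcM normc_real ger0_norm ?ler_wpM2r ?fb // ltnW.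
apply: le_trans (normc_sum _ _ _) _; apply: ler_sum_nat => n /andP[an _].
rewrite normcM normc_real ger0_norm ?ler_wpM2r ?subr_ge0 //; by have /andP[] := f_dec n an.
Qed.

(** The limit is the supremum of the lower bounds u n - c n, which keeps the error explicit. *)
Lemma real_tail_limit (u c : nat -> R) : (forall m, 0 <= c m) ->
  (forall m n, (m <= n)%N -> `|u n - u m| <= c m) ->
  exists l, forall m, `|u m - l| <= c m.
Proof.
move=> c0 uc; pose E := [set u n - c n | n in [set: nat]].
have ub m n : u n - c n <= u m + c m.
  have [mn|/ltnW nm] := leqP m n.
    by have := uc _ _ mn; have := c0 n; rewrite ler_norml => ? /andP[]; lra.
  by have := uc _ _ nm; have := c0 m; rewrite ler_norml => ? /andP[]; lra.
have Eub m : ubound E (u m + c m) by move=> _ [n _ <-]; exact: ub.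
have E_sup : has_sup E by split; [exists (u 0%N - c 0%N), 0%N|exists (u 0%N + c 0%N)].
exists (sup E) => m; rewrite ler_norml.
have : u m - c m <= sup E by apply: (sup_upper_bound E_sup); exists m.
have : sup E <= u m + c m by apply: ge_sup (Eub m); exact: E_sup.1.
by move=> ? ?; apply/andP; split; lra.
Qed.

(** The factor 2 comes from treating real and imaginary parts separately. *)
Lemma complex_tail_limit (u : nat -> C) (c : nat -> R) : (forall m, 0 <= c m) ->
  (forall m n, (m <= n)%N -> normc (u n - u m) <= c m) ->
  exists l, forall m, normc (u m - l) <= 2 * c m.
Proof.
move=> c0 uc.
have [a aP] : exists l, forall m, `|complex.Re (u m) - l| <= c m.
  apply: real_tail_limit => // m n mn; apply: le_trans (uc m n mn).
  have -> : complex.Re (u n) - complex.Re (u m) = complex.Re (u n - u m).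
    by case: (u n) (u m) => [x y] [x' y'].
  exact: normc_ge_re.
have [b bP] : exists l, forall m, `|complex.Im (u m) - l| <= c m.
  apply: real_tail_limit => // m n mn; apply: le_trans (uc m n mn).
  have -> : complex.Im (u n) - complex.Im (u m) = complex.Im (u n - u m).
    by case: (u n) (u m) => [x y] [x' y'].
  exact: normc_ge_im.
exists (a +i* b) => m; apply: le_trans (normc_le_reim _) _.
by have := aP m; have := bP m; case: (u m) => x y /= ? ?; lra.
Qed.
End ComplexNorm.

(** * Partial sums attached to L(1, f) *)

Section BoundedCharacter.
Variables (R : realType) (f : nat -> R[i]) (B : R).
Local Notation C := R[i].
Local Open Scope complex_scope.
Hypothesis f1 : f 1%N = 1.
Hypothesis fM : forall m n, f (m * n)%N = f m * f n.
Hypothesis f_le1 : forall n, normc (f n) <= 1.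
Hypothesis fB : forall a b, normc (\sum_(a <= n < b) f n) <= B.

Lemma partial_bound_ge0 : 0 <= B.
Proof. by apply: le_trans (fB 0 0); exact: normc_ge0. Qed.
Let B0 := partial_bound_ge0.

(** These three are the partial sums at s = 1 of the Dirichlet series of L, -L' and -L'/L. *)
Definition recip_sum x : C := \sum_(1 <= n < x.+1) f n * (n%:R^-1)%:C.
Definition log_sum x : C := \sum_(1 <= n < x.+1) f n * (ln n%:R / n%:R)%:C.
Definition mangoldt_sum x : C := \sum_(1 <= n < x.+1) f n * (mangoldt R n / n%:R)%:C.

Lemma recip_sum_tail m n : (m <= n)%N ->
  normc (recip_sum n - recip_sum m) <= B / m.+1%:R.
Proof.
move=> mn; rewrite /recip_sum (big_cat_nat (n := m.+1)) //= addrAC subrr add0r.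
apply: abel_bound => // k mk; rewrite invr_ge0 ler0n /= lef_pV2 ?posn ?ler_nat //.
exact: leq_trans mk.
Qed.

(** The limit is L(1, f). The error is written with d / x, the form that cancels a factor 1 / d in
    the sums over d below. *)
Lemma recip_sum_limit : exists L, forall x d, (0 < x)%N -> (0 < d)%N ->
  normc (recip_sum (x %/ d) - L) <= 2 * B * (d%:R / x%:R).
Proof.
have [L LP] := complex_tail_limit (fun m => divr_ge0 B0 (ler0n R m.+1)) recip_sum_tail.
exists L => x d x0 d0; apply: le_trans (LP _) _; rewrite -mulrA ler_wpM2l //.
rewrite ler_wpM2l // -[leRHS]invrK lef_pV2 ?posn //; last first.
  by rewrite posrE invr_gt0 divr_gt0 ?ltr0n.
by rewrite invf_div ler_pdivrMr ?ltr0n // -natrM ler_nat ltnW // ltn_ceil.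
Qed.

(** Partial summation starts at 4, where ln n >= 1 makes ln n / n decreasing; the first three terms
    are each at most 1. *)
Lemma log_sum_bound x : normc (log_sum x) <= 3 + B.
Proof.
have lnn n : 0 <= ln (n%:R : R) / n%:R <= 1.
  rewrite divr_ge0 ?ln_nat_ge0 //=; case: n => [|n]; first by rewrite ln0 // mul0r.
  by rewrite ler_pdivrMr ?ltr0n // mul1r ln_nat_le.
have small y : (y <= 3)%N -> normc (log_sum y) <= 3.
  move=> y3; apply: le_trans (normc_sum _ _ _) _.
  apply: (@le_trans _ _ (\sum_(1 <= n < y.+1) 1)); last first.
    by rewrite sumr_const_nat subn1 ler_nat.
  apply: ler_sum => n _; rewrite normcM normc_real; have /andP[h0 h1] := lnn n.
  by rewrite ger0_norm // mulr_ile1 ?normc_ge0.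
have [x3|x3] := leqP x 3; first by rewrite (le_trans (small x x3)) // lerDl.
rewrite /log_sum (big_cat_nat (n := 4)) //=; last by rewrite ltnW.
apply: le_trans (le_normcD _ _) _; rewrite lerD //; first exact: (small 3%N).
have /andP[h0 h1] := lnn 4%N.
apply: (@le_trans _ _ (B * (ln 4%:R / 4%:R))); last by rewrite ler_piMr.
apply: (abel_bound (f := fun n => ln n%:R / n%:R)) => // n n4.
have n0 : (0 < n)%N by apply: leq_trans n4.
have /andP[-> _] := lnn n.+1.
have nR : 0 < n%:R :> R by rewrite ltr0n.
rewrite ler_pdivrMr ?ltr0n // mulrAC ler_pdivlMr //.
have := ln_natS_le R n0; rewrite -(ler_pM2l nR) divff ?gt_eqF //.
have ln4 : 1 <= ln (4%:R : R).
  have : ln (4%:R : R) = 2 * ln 2%:R.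
    by rewrite (_ : 4 = 2 * 2)%N // ln_natM //; ring.
  have : ln (2%:R^-1 : R) <= - 2%:R^-1.
    have := @le_ln1Dx R (- 2%:R^-1); rewrite (_ : 1 + - 2%:R^-1 = 2%:R^-1); last by lra.
    by apply; lra.
  rewrite lnV ?posn //; lra.
have -> : n.+1%:R = n%:R + 1 :> R by rewrite natr1.
have := ler_ln_nat R n4; move: ln4.
by set u := ln 4%:R; set v := ln n%:R; set t := ln (_ + 1) => ? ? ?; lra.
Qed.

(** The identity -L' = (-L'/L) L for partial sums: ln n is the sum of [mangoldt] over the divisors
    of n, and f n = f d f(n / d). *)
Lemma log_sumE x :
  log_sum x = \sum_(1 <= d < x.+1) f d * (mangoldt R d / d%:R)%:C * recip_sum (x %/ d).
Proof.
transitivity (\sum_(1 <= n < x.+1) \sum_(d <- divisors n)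
    f d * (mangoldt R d / d%:R)%:C * (f (n %/ d)%N * ((n %/ d)%:R^-1)%:C)).
  apply: eq_big_nat => n /andP[n0 _]; rewrite -(sum_mangoldt R n0) mulr_suml.
  rewrite rmorph_sum mulr_sumr !big_seq; apply: eq_bigr => d.
  rewrite -dvdn_divisors // => dn; rewrite -{1 2}(divnK dn) mulnC fM natrM invfM.
  by rewrite !rmorphM /=; ring.
rewrite (sum_divisors_resum x (fun d m => f d * (mangoldt R d / d%:R)%:C *
   (f m * (m%:R^-1)%:C))).
by apply: eq_bigr => d _; rewrite mulr_sumr.
Qed.

(* Moebius inversion: sum_(d | n) mu(d) ln (x / d) = Lambda(n) + [n = 1] ln x. *)
Lemma mangoldt_sumE x : (0 < x)%N ->
  \sum_(1 <= d < x.+1) f d * ((moebius d)%:~R * (ln x%:R - ln d%:R) / d%:R)%:C *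
    recip_sum (x %/ d) = mangoldt_sum x + (ln x%:R)%:C.
Proof.
move=> x0.
transitivity (\sum_(1 <= n < x.+1) \sum_(d <- divisors n)
    f d * ((moebius d)%:~R * (ln x%:R - ln d%:R) / d%:R)%:C *
      (f (n %/ d)%N * ((n %/ d)%:R^-1)%:C)).
  rewrite (sum_divisors_resum x (fun d m =>
     f d * ((moebius d)%:~R * (ln x%:R - ln d%:R) / d%:R)%:C * (f m * (m%:R^-1)%:C))).
  by apply: eq_bigr => d _; rewrite mulr_sumr.
transitivity (\sum_(1 <= n < x.+1) f n * ((mangoldt R n + (n == 1)%:R * ln x%:R) / n%:R)%:C).
  apply: eq_big_nat => n /andP[n0 _].
  have -> : mangoldt R n + (n == 1)%:R * ln x%:R =
     \sum_(d <- divisors n) (moebius d)%:~R * (ln x%:R - ln d%:R).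
    rewrite -(mangoldt_moebius R n0).
    have -> : (n == 1)%:R * ln (x%:R : R) = (n == 1)%:R * (ln x%:R - ln n%:R).
      by case: eqP => [->|]; rewrite ?ln1 ?subr0 ?mul0r.
    have -> : (n == 1)%:R = (\sum_(d <- divisors n) moebius d)%:~R :> R.
      by rewrite sum_moebius // rmorph_nat.
    rewrite rmorph_sum mulr_suml -big_split !big_seq; apply: eq_bigr => d /=.
    rewrite -dvdn_divisors // => dn; rewrite -{2}(divnK dn) ln_natM ?(dvdn_gt0 n0 dn) //.
      ring.
    by rewrite divn_gt0 ?(dvdn_leq n0 dn) ?(dvdn_gt0 n0 dn).
  rewrite mulr_suml rmorph_sum mulr_sumr !big_seq; apply: eq_bigr => d.
  rewrite -dvdn_divisors // => dn; rewrite -{3 4}(divnK dn) mulnC fM natrM invfM.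
  by rewrite !rmorphM /=; ring.
rewrite /mangoldt_sum; under eq_bigr do rewrite mulrDl rmorphD mulrDr.
rewrite big_split /=; congr (_ + _); rewrite (big_ltn (_ : (1 < x.+1)%N)) //.
rewrite f1 mul1r divr1 mul1r big_nat big1 ?addr0 // => n /andP[n1 _].
by rewrite gtn_eqF // !mul0r mulr0.
Qed.

(** Replacing [recip_sum (x %/ d)] by L in [log_sumE] costs at most 2 B [psi x] / x <= 8 B; with the
    bound 3 + B of [log_sum] this gives 3 + 9 B. *)
Lemma mangoldt_sum_bounded L : L != 0 ->
  (forall x d, (0 < x)%N -> (0 < d)%N ->
    normc (recip_sum (x %/ d) - L) <= 2 * B * (d%:R / x%:R)) ->
  exists K, forall x, (0 < x)%N -> normc (mangoldt_sum x) <= K.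
Proof.
move=> L0 LP; exists ((3 + 9 * B) / normc L) => x x0.
have nL0 : 0 < normc L.
  by rewrite lt_neqAle normc_ge0 andbT eq_sym; apply: contraNneq L0 => /eq0_normc ->.
rewrite ler_pdivlMr // -normcM.
have -> : mangoldt_sum x * L = log_sum x -
    \sum_(1 <= d < x.+1) f d * (mangoldt R d / d%:R)%:C * (recip_sum (x %/ d) - L).
  rewrite log_sumE /mangoldt_sum mulr_suml -sumrB; apply: eq_bigr => d _.
  by rewrite mulrBr opprB addrC subrK.
apply: le_trans (normcB _ _) _.
have -> : 3 + 9 * B = (3 + B) + 2 * B * 4 by ring.
rewrite lerD ?log_sum_bound //; apply: le_trans (normc_sum _ _ _) _.
have xR : 0 < x%:R :> R by rewrite ltr0n.
apply: (@le_trans _ _ (\sum_(1 <= d < x.+1) 2 * B * (mangoldt R d / x%:R))).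
  apply: ler_sum_nat => d /andP[d0 _]; rewrite !normcM normc_real.
  have dR : 0 < d%:R :> R by rewrite ltr0n.
  have md : 0 <= mangoldt R d / d%:R by rewrite divr_ge0 ?mangoldt_ge0.
  rewrite ger0_norm //; apply: (@le_trans _ _ (1 * (mangoldt R d / d%:R) * (2 * B * (d%:R / x%:R)))).
    apply: ler_pM; [by rewrite mulr_ge0 ?normc_ge0|exact: normc_ge0|by rewrite ler_wpM2r|].
    exact: LP.
  rewrite mul1r mulrCA ler_wpM2l ?mulr_ge0 //.
  by rewrite mulrA divfK ?gt_eqF.
rewrite -mulr_sumr -mulr_suml ler_wpM2l ?mulr_ge0 // ler_pdivrMr //; exact: psi_le.
Qed.

(** When L(1, f) = 0 the left side of [mangoldt_sumE] is at most (2 B / x) times the sum of ln (x /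
    d), and x ln x - ln (x!) <= x. *)
Lemma mangoldt_sum_log :
  (forall x d, (0 < x)%N -> (0 < d)%N ->
    normc (recip_sum (x %/ d)) <= 2 * B * (d%:R / x%:R)) ->
  exists K, forall x, (0 < x)%N -> normc (mangoldt_sum x + (ln x%:R)%:C) <= K.
Proof.
move=> LP; exists (2 * B) => x x0; rewrite -mangoldt_sumE //.
have xR : 0 < x%:R :> R by rewrite ltr0n.
apply: le_trans (normc_sum _ _ _) _.
apply: (@le_trans _ _ (\sum_(1 <= d < x.+1) 2 * B * ((ln x%:R - ln d%:R) / x%:R))).
  apply: ler_sum_nat => d /andP[d0 dx]; rewrite !normcM normc_real.
  have dR : 0 < d%:R :> R by rewrite ltr0n.
  have lnd : 0 <= ln (x%:R : R) - ln d%:R by rewrite subr_ge0 ler_ln_nat.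
  have LPd := LP x d x0 d0.
  apply: (@le_trans _ _ (1 * ((ln x%:R - ln d%:R) / d%:R) * (2 * B * (d%:R / x%:R)))).
    apply: ler_pM; [by rewrite mulr_ge0 ?normc_ge0|exact: normc_ge0| |exact: LPd].
    apply: ler_pM; rewrite ?normc_ge0 // !normrM (ger0_norm lnd).
    rewrite (@ger0_norm _ d%:R^-1) ?invr_ge0 //.
    rewrite ler_wpM2r ?invr_ge0 // ler_piMl // -intr_norm -[leRHS]/(1%:~R) ler_int.
    exact: normr_moebius_le1.
  rewrite mul1r mulrCA ler_wpM2l ?mulr_ge0 //.
  by rewrite mulrA divfK ?gt_eqF.
rewrite -mulr_sumr -[leRHS]mulr1 ler_wpM2l ?mulr_ge0 // -mulr_suml ler_pdivrMr // mul1r.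
rewrite sumrB sumr_const_nat subn1 -[ln _ *+ _]mulr_natl.
have := log_fact_ge R x; rewrite /log_fact /=; lra.
Qed.
End BoundedCharacter.

(* Let r = 1 * g.  If L(1, g) = 0, then for x = k^6 the sum of r(n) (x - n) over
   n <= x is O(k^8): swap the sums, use the explicit weights for d <= k^4 and their
   monotonicity beyond.  But r >= 0 and r >= 1 on squares make it at least k^9 / 4. *)
Section RealCharacter.
Variables (R : realType) (g : nat -> R).
Hypothesis g1 : g 1%N = 1.
Hypothesis gM : forall m n, g (m * n)%N = g m * g n.
Hypothesis g_val : forall n, [\/ g n = 0, g n = 1 | g n = -1].

Let r n := \sum_(d <- divisors n) g d.

(** The factor of 1 * g at p^a: for t = 0, 1, -1 it is 1, a + 1, and 1 or 0 according to the parity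
    of a. *)
Lemma geometric_sign (t : R) (a : nat) : [\/ t = 0, t = 1 | t = -1] ->
  0 <= \sum_(j < a.+1) t ^+ j /\ (~~ odd a -> 1 <= \sum_(j < a.+1) t ^+ j).
Proof.
case=> ->.
- rewrite big_ord_recl expr0 big1 ?addr0 ?ler01 ?lexx // => i _.
  by rewrite expr0n.
- rewrite (eq_bigr (fun=> 1)) => [|i _]; last by rewrite expr1n.
  by rewrite sumr_const card_ord ler0n ler1n.
- have -> : \sum_(j < a.+1) (-1) ^+ j = (~~ odd a)%:R :> R.
    elim: a => [|a IHa]; first by rewrite big_ord1 expr0.
    by rewrite big_ord_recr IHa /= -signr_odd /=; case: (odd a); rewrite /=; ring.
  by case: (odd a); rewrite ?lexx ?ler01.
Qed.

Lemma char_divisor_sumM p a m : prime p -> ~~ (p %| m)%N -> (0 < m)%N ->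
  r (p ^ a * m)%N = (\sum_(j < a.+1) g p ^+ j) * r m.
Proof.
move=> pp pNm m0; rewrite /r big_divisors_primeM // mulr_suml; apply: eq_bigr => j _.
rewrite mulr_sumr; apply: eq_bigr => d _; rewrite gM; congr (_ * _).
elim: (j : nat) => [|i IHi]; first by rewrite expn0 g1 expr0.
by rewrite expnS gM IHi exprS.
Qed.

Lemma char_divisor_sum_ge0 n : (0 < n)%N -> 0 <= r n.
Proof.
move: n; apply: nat_primeM_ind => [|p a m pp a0 m0 pNm IHm].
  by rewrite /r (_ : divisors 1 = [:: 1%N]) // big_seq1 g1.
by rewrite char_divisor_sumM // mulr_ge0 //; have [] := geometric_sign a (g_val p).
Qed.

Lemma char_divisor_sum_sqr n : (0 < n)%N -> 1 <= r (n ^ 2)%N.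
Proof.
move: n; apply: nat_primeM_ind => [|p a m pp a0 m0 pNm IHm].
  by rewrite exp1n /r (_ : divisors 1 = [:: 1%N]) // big_seq1 g1.
rewrite expnMn -expnM char_divisor_sumM ?expn_gt0 ?m0 ?Euclid_dvdX //; last first.
  by rewrite negb_and pNm.
have [_ ge1] := geometric_sign (a * 2) (g_val p).
by rewrite -[1]mulr1 ler_pM // ge1 // oddM andbF.
Qed.

(** The natural subtraction cuts off at 0, so m may run up to x for every d; this makes V x
    decreasing in d, as partial summation requires. *)
Let V x d : R := \sum_(1 <= m < x.+1) (x - m * d)%N%:R.

Lemma char_weight_trunc x d : (0 < d)%N ->
  \sum_(1 <= m < (x %/ d).+1) (x%:R - (d * m)%:R) = V x d.
Proof.
move=> d0; have le1 : ((x %/ d).+1 <= x.+1)%N by rewrite ltnS leq_div.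
rewrite /V [RHS](big_cat_nat (n := (x %/ d).+1)) //=.
rewrite [X in _ = _ + X]big_nat [X in _ = _ + X]big1 ?addr0 => [|m /andP[mx _]].
  apply: eq_big_nat => m /andP[_ mx]; rewrite natrB mulnC //.
  by rewrite mulnC -leq_divRL.
by apply/eqP; rewrite pnatr_eq0 subn_eq0 ltnW // -ltn_divLR.
Qed.

(** With x = M d + s, the sum is x M - d M (M + 1) / 2, and the exact error is s (d - s) / (2 d). *)
Lemma char_weightE x d : (0 < d)%N -> exists2 e : R, 0 <= e <= d%:R / 2 &
  V x d = x%:R ^+ 2 / (2 * d%:R) - x%:R / 2 + e.
Proof.
move=> d0; have dR : 0 < d%:R :> R by rewrite ltr0n.
have -> : V x d = x%:R * (x %/ d)%:R - d%:R * ((x %/ d)%:R * ((x %/ d)%:R + 1) / 2).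
  rewrite -char_weight_trunc // sumrB sumr_const_nat subn1 /= mulr_natr; congr (_ - _).
  elim: (x %/ d)%N => [|M IHM]; first by rewrite big_geq // mul0r mul0r mulr0.
  rewrite big_nat_recr //= IHM natrM.
  have -> : M.+1%:R = M%:R + 1 :> R by rewrite natr1.
  by field.
set M : R := (x %/ d)%:R; set s : R := (x %% d)%:R.
have xE : x%:R = M * d%:R + s by rewrite /M /s -natrM -natrD -divn_eq.
have s0 : 0 <= s by rewrite ler0n.
have sd : s <= d%:R by rewrite ler_nat ltnW // ltn_mod.
exists (s * (d%:R - s) / (2 * d%:R)).
  rewrite divr_ge0 ?mulr_ge0 ?subr_ge0 //=.
  rewrite ler_pdivrMr ?mulr_gt0 // (_ : d%:R / 2 * (2 * d%:R) = d%:R * d%:R); last by field.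
  by rewrite ler_pM ?subr_ge0 // gerBl.
by rewrite xE; field; rewrite gt_eqF.
Qed.

Lemma char_weight_le x d : (0 < d <= x)%N -> V x d <= x%:R ^+ 2 / (2 * d%:R).
Proof.
case/andP=> d0 dx; have [e /andP[_ ed] ->] := char_weightE x d0.
have : d%:R <= x%:R :> R by rewrite ler_nat.
by move: ed; set u := _ / (_ * _) => ? ?; lra.
Qed.

Lemma char_weight_sum x :
  \sum_(1 <= n < x.+1) r n * (x%:R - n%:R) = \sum_(1 <= d < x.+1) g d * V x d.
Proof.
transitivity (\sum_(1 <= n < x.+1) \sum_(d <- divisors n)
    g d * (x%:R - (d * (n %/ d))%:R)).
  apply: eq_big_nat => n /andP[n0 _]; rewrite mulr_suml !big_seq; apply: eq_bigr => d.
  by rewrite -dvdn_divisors // => dn; rewrite mulnC divnK.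
rewrite (sum_divisors_resum x (fun d m => g d * (x%:R - (d * m)%:R))).
by apply: eq_big_nat => d /andP[d0 _]; rewrite -mulr_sumr char_weight_trunc.
Qed.

(** Keep only the squares m^2 with m <= y = k^3, where r is at least 1. As y^2 - m^2 >= y (y - m),
    they contribute at least y^2 (y - 1) / 2 >= y^3 / 4. *)
Lemma char_weight_lower k : (1 < k)%N ->
  k%:R ^+ 9 / 4 <= \sum_(1 <= n < (k ^ 6).+1) r n * ((k ^ 6)%:R - n%:R).
Proof.
move=> k1; set x := (k ^ 6)%N; set y := (k ^ 3)%N.
have xy : x = (y * y)%N by rewrite /x /y -expnD.
apply: (@le_trans _ _ (\sum_(1 <= m < y.+1) (x%:R - (m ^ 2)%:R))).
  apply: (@le_trans _ _ (\sum_(1 <= m < y.+1) y%:R * (y%:R - m%:R))); last first.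
    apply: ler_sum_nat => m /andP[_ my]; rewrite xy natrM natrX.
    have my' : m%:R <= y%:R :> R by rewrite ler_nat.
    have m0 : 0 <= m%:R :> R by rewrite ler0n.
    have : 0 <= m%:R * (y%:R - m%:R) :> R by rewrite mulr_ge0 // subr_ge0.
    rewrite expr2; lra.
  rewrite -mulr_sumr sumrB sumr_const_nat subn1 -[y%:R *+ _]mulr_natl /=.
  have -> : \sum_(1 <= m < y.+1) m%:R = y%:R * (y%:R + 1) / 2 :> R.
    elim: (y) => [|z IHz]; first by rewrite big_geq // !mul0r.
    rewrite big_nat_recr //= IHz; have -> : z.+1%:R = z%:R + 1 :> R by rewrite natr1.
    by field.
  have -> : k%:R ^+ 9 = y%:R ^+ 3 :> R by rewrite /y natrX -exprM.
  have y2 : 2 <= y%:R :> R.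
    by rewrite ler_nat /y (leq_trans k1) // -{1}(expn1 k) leq_exp2l.
  have -> : y%:R * (y%:R * y%:R - y%:R * (y%:R + 1) / 2) =
      y%:R ^+ 3 / 4 + y%:R * y%:R * (y%:R - 2) / 4 :> R by field.
  by rewrite lerDl !mulr_ge0 ?subr_ge0 ?invr_ge0.
apply: (@le_trans _ _ (\sum_(1 <= m < y.+1) \sum_(1 <= n < x.+1)
    (n == m ^ 2)%N%:R * (x%:R - n%:R))).
  apply: ler_sum_nat => m /andP[m0 my].
  have mx : (m ^ 2 \in index_iota 1 x.+1)%N.
    by rewrite mem_index_iota expn_gt0 m0 ltnS xy -mulnn leq_mul.
  rewrite (bigD1_seq (m ^ 2)%N) ?iota_uniq //= eqxx mul1r lerDl sumr_ge0 // => n.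
  by move=> /negbTE ->; rewrite mul0r.
rewrite exchange_big /=; apply: ler_sum_nat => n /andP[n0 nx].
rewrite -mulr_suml ler_wpM2r ?subr_ge0 ?ler_nat //.
have [[m nE]|nsq] := pselect (exists m, n = (m ^ 2)%N).
  have m0 : (0 < m)%N by move: n0; rewrite nE; case: m {nE}.
  apply: (@le_trans _ _ 1); last by rewrite nE char_divisor_sum_sqr.
  rewrite -natr_sum -[leRHS]/(1%:R) ler_nat nE.
  have [my|my] := boolP (m \in index_iota 1 y.+1); last first.
    rewrite big_seq big1 // => i iy; apply/eqP; rewrite eqb0 eqn_exp2r //.
    by apply: contraNN my => /eqP ->.
  rewrite (bigD1_seq m) ?iota_uniq //= eqxx big1 // => i im.
  by rewrite eqn_exp2r // eq_sym (negbTE im).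
rewrite big1 ?char_divisor_sum_ge0 // => m _; case: eqP => // nE.
by case: nsq; exists m.
Qed.

Lemma real_char_nonvanishing (B c : R) : 0 <= c ->
  (forall a b, `|\sum_(a <= n < b) g n| <= B) ->
  ~ (forall x, (0 < x)%N -> `|\sum_(1 <= n < x.+1) g n / n%:R| <= c / x%:R).
Proof.
move=> c0 gB sB; have B0 : 0 <= B by apply: le_trans (gB 0 0).
(* The upper bounds below add up to (c / 2 + B + 1) k^8, which this k makes smaller than k^9 / 4. *)
have [k k1 kbig] : exists2 k, (1 < k)%N & 4 * (c / 2 + B + 1) < k%:R.
  exists (Num.bound (4 * (c / 2 + B + 1))).+2 => //.
  apply: lt_trans (archi_boundP _) _; first by rewrite mulr_ge0 //; lra.
  by rewrite ltr_nat.
have := char_weight_lower k1; rewrite char_weight_sum.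
set x := (k ^ 6)%N; pose D := (k ^ 4)%N.
have k0 : (0 < k)%N by exact: ltnW.
have D0 : (0 < D)%N by rewrite expn_gt0 k0.
have DR : 0 < D%:R :> R by rewrite ltr0n.
have Dx : (D < x)%N by rewrite ltn_exp2l.
have kR : 0 < k%:R :> R by rewrite ltr0n.
have xD : x%:R ^+ 2 / D%:R = k%:R ^+ 8 :> R.
  by rewrite /x /D !natrX -exprM (_ : 6 * 2 = 8 + 4)%N // exprD mulfK // expf_neq0 // gt_eqF.
rewrite (big_cat_nat (n := D.+1)) //= ?ltnS ?(ltnW Dx) //.
(* For d > D = k^4, partial summation leaves B V(x, D + 1) <= B x^2 / (2 D), and x^2 / D = k^8. *)
have bound2 : \sum_(D.+1 <= d < x.+1) g d * V x d <= B * k%:R ^+ 8 / 2.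
  apply: (@le_trans _ _ (B * V x D.+1)).
    apply: le_trans (ler_norm _) _; rewrite -normc_real rmorph_sum /=.
    under eq_bigr do rewrite rmorphM.
    apply: (abel_bound (u := fun n => real_complex R (g n)) (f := V x)).
    - by move=> m; rewrite -rmorph_sum normc_real.
    - move=> n _; rewrite sumr_ge0 //=; apply: ler_sum => m _.
      by rewrite ler_nat leq_sub2l // leq_mul2l leqnSn orbT.
    - exact: sumr_ge0.
  rewrite -mulrA ler_wpM2l // -xD; apply: le_trans (char_weight_le _) _ => //.
  have -> : x%:R ^+ 2 / D%:R / 2 = x%:R ^+ 2 / (2 * D%:R) :> R by rewrite invfM; ring.
  rewrite ler_wpM2l ?sqr_ge0 // lef_pV2 ?posrE ?mulr_gt0 ?ltr0n //.
  by rewrite ler_wpM2l // ler_nat.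
(* For d <= D the three parts of [char_weightE] are bounded by the rate c / D, by B, and by D times
   D = k^8 respectively. *)
have bound1 : \sum_(1 <= d < D.+1) g d * V x d <=
   c * k%:R ^+ 8 / 2 + B * k%:R ^+ 6 / 2 + k%:R ^+ 8.
  pose e d := V x d - (x%:R ^+ 2 / (2 * d%:R) - x%:R / 2).
  have -> : \sum_(1 <= d < D.+1) g d * V x d =
      x%:R ^+ 2 / 2 * \sum_(1 <= d < D.+1) g d / d%:R
      - x%:R / 2 * \sum_(1 <= d < D.+1) g d + \sum_(1 <= d < D.+1) g d * e d.
    rewrite !mulr_sumr -sumrB -big_split; apply: eq_bigr => d _ /=.
    by rewrite /e invfM; ring.
  apply: lerD; first apply: lerD.
  - apply: (@le_trans _ _ (x%:R ^+ 2 / 2 * (c / D%:R))); last by rewrite -xD; lra.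
    by rewrite ler_wpM2l ?divr_ge0 ?sqr_ge0 // (le_trans (ler_norm _)) // sB.
  - rewrite -mulrN; apply: (@le_trans _ _ (x%:R / 2 * B)).
      by rewrite ler_wpM2l ?divr_ge0 // (le_trans (ler_norm _)) // normrN gB.
    by rewrite /x natrX; lra.
  - apply: (@le_trans _ _ (\sum_(1 <= d < D.+1) D%:R)); last first.
      by rewrite sumr_const_nat subn1 -[D%:R *+ _]mulr_natr /D natrX -exprD.
    apply: ler_sum_nat => d /andP[d0 dD].
    have [e' /andP[e0 e2] eE] := char_weightE x d0.
    have -> : e d = e' by rewrite /e eE addrC addKr.
    have dD' : d%:R <= D%:R :> R by rewrite ler_nat.
    by case: (g_val d) => ->; lra.
have k86 : k%:R ^+ 6 <= k%:R ^+ 8 :> R.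
  by rewrite ler_weXn2l // ler1n.
have k8 : 0 < k%:R ^+ 8 :> R by rewrite exprn_gt0.
have Bk : B * k%:R ^+ 6 <= B * k%:R ^+ 8 by rewrite ler_wpM2l.
move: kbig; rewrite -(ltr_pM2l k8) [k%:R ^+ 9]exprSr.
lra.
Qed.
End RealCharacter.

(** * Sums of periodic functions *)

Section PeriodSums.
Variables (R : realType) (N : nat) (f : nat -> R[i]).
Local Notation C := R[i].
Hypothesis N0 : (0 < N)%N.
Hypothesis f_mod : forall n, f (n %% N)%N = f n.
Hypothesis f_le1 : forall n, normc (f n) <= 1.

(** Sums from 0 depend only on the endpoint modulo N, so each is at most N in norm; a general sum is
    a difference of two. *)
Lemma period_sum_bound : \sum_(0 <= n < N) f n = 0 ->
  forall a b, normc (\sum_(a <= n < b) f n) <= 2 * N%:R.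
Proof.
move=> f0; pose S m := \sum_(0 <= n < m) f n.
have SN m : S (N + m)%N = S m.
  rewrite /S (big_cat_nat (n := N)) //= ?leq_addr // f0 add0r.
  rewrite -{1}[N]add0n big_addn addKn; apply: eq_bigr => n _.
  by rewrite -f_mod modnDr f_mod.
have S_mod m : S m = S (m %% N)%N.
  rewrite {1}(divn_eq m N); elim: (m %/ N)%N => [|k IHk]; first by rewrite mul0n.
  by rewrite mulSn -addnA SN.
have S_le m : normc (S m) <= N%:R.
  rewrite S_mod; apply: le_trans (normc_sum _ _ _) _.
  apply: (@le_trans _ _ (\sum_(0 <= n < m %% N) 1)); first exact: ler_sum.
  by rewrite sumr_const_nat subn0 ler_nat ltnW // ltn_mod.
move=> a b; have [ba|ab] := leqP b a; first by rewrite big_geq // normc0 mulr_ge0.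
have -> : \sum_(a <= n < b) f n = S b - S a.
  by rewrite /S [X in _ = X - _](big_cat_nat (n := a)) ?(ltnW ab) //= addrAC subrr add0r.
by apply: le_trans (normcB _ _) _; have := S_le a; have := S_le b; lra.
Qed.

(** Multiplication by a permutes the residues, so the sum is unchanged when multiplied by f a. *)
Lemma period_sum_eq0 (a : nat) : (forall m n, f (m * n)%N = f m * f n) ->
  coprime a N -> f a != 1 -> \sum_(0 <= n < N) f n = 0.
Proof.
move=> fM ca fa1; rewrite big_mkord; pose h (i : 'I_N) := Ordinal (ltn_pmod (a * i)%N N0).
have h_inj : injective h.
  move=> i j /(congr1 val) /= /eqP E; apply: val_inj => /=.
  wlog ij : i j E / (j <= i)%N => [W|].
    by have [/W ->//|/ltnW/W W1] := leqP j i; rewrite W1 // eq_sym.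
  move: E; rewrite eqn_mod_dvd ?leq_mul2l ?ij ?orbT // -mulnBr.
  rewrite Gauss_dvdr 1?coprime_sym // -eqn_mod_dvd // => /eqP.
  by rewrite !modn_small.
have : f a * (\sum_(i < N) f i) = \sum_(i < N) f i.
  rewrite [in RHS](reindex_inj h_inj) mulr_sumr; apply: eq_bigr => i _ /=.
  by rewrite f_mod fM.
move/eqP; rewrite -subr_eq0 -[X in _ - X]mul1r -mulrBl mulf_eq0 subr_eq0 (negbTE fa1).
by move/eqP.
Qed.
End PeriodSums.

(** Prime terms stop at Q and the others total at most 2. This serves both for the primes dividing N
    and for the contradiction in [dirichlet]. *)
Lemma mangoldt_filter_le (R : realType) (P : pred nat) (Q x : nat) :
  (forall n, prime n -> P n -> (n <= Q)%N) ->
  \sum_(1 <= n < x.+1 | P n) mangoldt R n / n%:R <=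
  2 + \sum_(1 <= n < Q.+1) mangoldt R n / n%:R.
Proof.
move=> PQ; have t0 n : 0 <= mangoldt R n / n%:R by rewrite divr_ge0 ?mangoldt_ge0.
apply: (@le_trans _ _ (\sum_(1 <= n < x.+1 | ~~ prime n) mangoldt R n / n%:R +
    \sum_(1 <= n < x.+1 | (n <= Q)%N) mangoldt R n / n%:R)).
  rewrite big_mkcond [X in _ <= X + _]big_mkcond [X in _ <= _ + X]big_mkcond -big_split /=.
  apply: ler_sum => n _; case: (boolP (P n)) => Pn; last by rewrite addr_ge0 //; case: ifP.
  case: (boolP (prime n)) => pn /=; last by rewrite lerDl; case: ifP.
  by rewrite (PQ n pn Pn) add0r.
rewrite lerD ?mangoldt_nonprime_le //.
have [xQ|Qx] := leqP x Q.
  rewrite [leRHS](big_cat_nat (n := x.+1)) //= big_mkcond /=.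
  apply: (@le_trans _ _ (\sum_(1 <= n < x.+1) mangoldt R n / n%:R)); last first.
    by rewrite lerDl sumr_ge0.
  by apply: ler_sum => n _; case: ifP.
rewrite (big_cat_nat (n := Q.+1)) //= ?ltnS ?(ltnW Qx) // [X in _ + X]big_nat_cond.
rewrite [X in _ + X]big_pred0 ?addr0 => [|n]; last first.
  by apply/negP => /andP[/andP[Qn _]]; rewrite leqNgt Qn.
by rewrite big_mkcond; apply: ler_sum => n _; case: ifP.
Qed.

Lemma complex_norm_normc (R : realType) (z : R[i]) : `|z| = real_complex R (normc z).
Proof. by []. Qed.

Lemma normc_conj (R : realType) (z : R[i]) : normc (z^*) = normc z.
Proof. by apply: (@complexI R); rewrite -!complex_norm_normc norm_conjC. Qed.

Lemma conj_real_complex (R : realType) (r : R) :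
  (real_complex R r)^* = real_complex R r.
Proof. by apply/CrealP/complex_realP; exists r. Qed.

(** * Dirichlet's theorem on primes in arithmetic progressions *)

Section Dirichlet.
Variables (R : realType) (N : nat) (I : finType) (chi : I -> nat -> R[i]).
Variables (i0 : I) (cj : I -> I).
Hypothesis N1 : (1 < N)%N.
Hypothesis chiP : dirichlet_chars N chi i0 cj.
Local Notation C := R[i].
Local Notation "x %:C" := (real_complex R x) : ring_scope.

Let B : R := 2 * N%:R.
Let N0 : (0 < N)%N. Proof. exact: ltnW. Qed.

Lemma dchar_le1 i n : normc (chi i n) <= 1.
Proof.
have [cn|/(dchar0 chiP) ->] := boolP (coprime n N); last by rewrite normc0.
by rewrite -lecR -complex_norm_normc (dchar_norm chiP).
Qed.

Lemma dchar_partial_bound i : i != i0 ->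
  forall a b, normc (\sum_(a <= n < b) chi i n) <= B.
Proof.
move=> ni; have [a ca chia] := dchar_nontriv chiP ni.
apply: period_sum_bound N0 (dchar_mod chiP i) (dchar_le1 i) _.
exact: (period_sum_eq0 N0 (dchar_mod chiP i) (dcharM chiP i) ca chia).
Qed.

(* L(1, chi_i) = 0, in the form of the rate of convergence of its partial sums. *)
Definition L_zero i := forall x d, (0 < x)%N -> (0 < d)%N ->
  normc (recip_sum (chi i) (x %/ d)) <= 2 * B * (d%:R / x%:R).

Lemma L_zero_cj i : L_zero i -> L_zero (cj i).
Proof.
move=> Zi x d x0 d0; have := Zi x d x0 d0.
suff -> : recip_sum (chi (cj i)) (x %/ d) = (recip_sum (chi i) (x %/ d))^*.
  by rewrite normc_conj.
rewrite /recip_sum rmorph_sum; apply: eq_bigr => n _.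
by rewrite rmorphM /= conj_real_complex (dchar_cj chiP).
Qed.

(** The truth value of [L_zero] merges the vanishing and nonvanishing cases; summing |K i| over the
    finitely many characters makes the constant uniform. *)
Lemma mangoldt_sum_estimate : exists K : R, forall i x, i != i0 -> (0 < x)%N ->
  normc (mangoldt_sum (chi i) x + (`[< L_zero i >]%:R * ln x%:R)%:C) <= K.
Proof.
have /choice[K KP] : forall i, exists K : R, i != i0 -> forall x, (0 < x)%N ->
    normc (mangoldt_sum (chi i) x + (`[< L_zero i >]%:R * ln x%:R)%:C) <= K.
  move=> i; have [->|ni] := eqVneq i i0; first by exists 0.
  have fB := dchar_partial_bound ni.
  case: asboolP => [Zi|nZi].
    have [K KP] := mangoldt_sum_log (dchar1 chiP i) (dcharM chiP i) (dchar_le1 i) fB Zi.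
    by exists K => _ x x0; rewrite mul1r KP.
  have [L LP] := recip_sum_limit fB.
  have L0 : L != 0 by apply/eqP => L0; apply: nZi => x d x0 d0; rewrite -[recip_sum _ _]subr0 -L0; exact: LP.
  have [K KP] := mangoldt_sum_bounded (dcharM chiP i) (dchar_le1 i) fB L0 LP.
  by exists K => _ x x0; rewrite mul0r addr0 KP.
exists (\sum_i `|K i|) => i x ni x0; apply: le_trans (KP i ni x x0) _.
by rewrite (bigD1 i) //= (le_trans (ler_norm _)) // lerDl sumr_ge0.
Qed.

Definition class_sum (a x : nat) : R :=
  \sum_(1 <= n < x.+1 | (n == a %[mod N])%N) mangoldt R n / n%:R.

Definition coprime_sum (x : nat) : R :=
  \sum_(1 <= n < x.+1 | coprime n N) mangoldt R n / n%:R.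

Lemma class_sum_ge0 a x : 0 <= class_sum a x.
Proof. by apply: sumr_ge0 => n _; rewrite divr_ge0 ?mangoldt_ge0. Qed.

Lemma class_sumE a x : coprime a N ->
  \sum_i (chi i a)^* * mangoldt_sum (chi i) x = (#|I|%:R * class_sum a x)%:C.
Proof.
move=> ca; rewrite /mangoldt_sum; under eq_bigr do rewrite mulr_sumr.
rewrite exchange_big /= /class_sum [in RHS]big_mkcond [in RHS]mulr_sumr [RHS]rmorph_sum.
apply: eq_bigr => n _ /=.
under eq_bigr do rewrite mulrA; rewrite -mulr_suml (dchar_orth chiP) // natrM.
rewrite -[_%:R * _%:R * _]mulrA; case: eqP => _; rewrite ?mul1r ?mul0r ?mulr0 ?rmorph0 //.
by rewrite [RHS]rmorphM rmorph_nat.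
Qed.

Lemma principal_sumE x : mangoldt_sum (chi i0) x = (coprime_sum x)%:C.
Proof.
rewrite /mangoldt_sum /coprime_sum [in RHS]big_mkcond [RHS]rmorph_sum.
by apply: eq_bigr => n _; rewrite (dchar_i0 chiP); case: ifP; rewrite ?mul1r ?mul0r.
Qed.

Lemma coprime_sum_le x : (0 < x)%N -> coprime_sum x <= ln x%:R + 4.
Proof.
move=> x0; apply: le_trans (mertens_le R x0); rewrite /coprime_sum big_mkcond.
by apply: ler_sum => n _; case: ifP => // _; rewrite divr_ge0 ?mangoldt_ge0.
Qed.

Lemma coprime_sum_ge : exists c, forall x, (0 < x)%N -> ln x%:R - c <= coprime_sum x.
Proof.
exists (3 + \sum_(1 <= n < N.+1) mangoldt R n / n%:R) => x x0.
have := mertens_ge R x0; rewrite (bigID (fun n => coprime n N)) /= -/(coprime_sum x).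
have : \sum_(1 <= n < x.+1 | ~~ coprime n N) mangoldt R n / n%:R <=
    2 + \sum_(1 <= n < N.+1) mangoldt R n / n%:R.
  apply: mangoldt_filter_le => n pn; rewrite prime_coprime // negbK.
  exact: dvdn_leq.
lra.
Qed.

(** In the character expansion of the class sum, [coprime_sum] is the principal part and every other
    character contributes -ln x or 0, up to a bounded error. *)
Lemma class_sum_estimate : exists K : R, forall a x, coprime a N -> (0 < x)%N ->
  normc ((#|I|%:R * class_sum a x - coprime_sum x)%:C +
    (\sum_(i | i != i0) (chi i a)^* * `[< L_zero i >]%:R) * (ln x%:R)%:C) <= K.
Proof.
have [K KP] := mangoldt_sum_estimate; exists (\sum_(i : I | i != i0) K) => a x ca x0.
rewrite rmorphB /= -class_sumE // -principal_sumE (bigD1 i0) //=.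
rewrite (dchar_i0 chiP) ca conjC1 mul1r [X in X + _]addrAC subrr add0r.
rewrite mulr_suml -big_split /=; apply: le_trans (normc_sum _ _ _) _.
apply: ler_sum => i ni; rewrite -mulrA -mulrDr normcM normc_conj.
rewrite -[K]mul1r ler_pM ?normc_ge0 ?dchar_le1 //.
by have := KP i x ni x0; rewrite rmorphM rmorph_nat.
Qed.

(* The class of 1 has nonnegative weight, whereas each zero subtracts ln x from
   the principal contribution ln x. *)
Lemma L_zero_unique i j : i != i0 -> j != i0 -> L_zero i -> L_zero j -> i = j.
Proof.
move=> ni nj Zi Zj; apply/eqP; apply: contraT => nij.
have [K KP] := class_sum_estimate.
have [x x0 lnx] := ln_nat_unbounded (K + 4).
have := KP 1%N x (coprime1n N) x0.
have -> : \sum_(k | k != i0) (chi k 1%N)^* * `[< L_zero k >]%:R =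
    (\sum_(k | k != i0) `[< L_zero k >]%:R)%:C :> C.
  rewrite rmorph_sum; apply: eq_bigr => k _.
  by rewrite (dchar1 chiP) conjC1 mul1r rmorph_nat.
rewrite -rmorphM -rmorphD normc_real /= => le1.
have v2 : 2 <= \sum_(k | k != i0) `[< L_zero k >]%:R :> R.
  rewrite (bigD1 i) // (bigD1 j) /=; last by rewrite nj eq_sym nij.
  rewrite (asboolT Zi) (asboolT Zj) addrA lerDl sumr_ge0 //.
have P0 : 0 <= #|I|%:R * class_sum 1 x by rewrite mulr_ge0 ?class_sum_ge0.
have A1 := coprime_sum_le x0.
have ln0 := ln_nat_ge0 R x.
have : 2 * ln x%:R <= (\sum_(k | k != i0) `[< L_zero k >]%:R) * ln (x%:R : R).
  by rewrite ler_wpM2r.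
move: le1; rewrite ler_norml => /andP[_]; set v := \sum_(k | _) _.
lra.
Qed.

(** A zero for a character is also one for its conjugate, so uniqueness makes the character real;
    [real_char_nonvanishing] then applies. *)
Lemma L_nonzero i : i != i0 -> ~ L_zero i.
Proof.
move=> ni Zi; have cji : cj i = i.
  by apply: L_zero_unique => //; [exact: dchar_cj0 chiP _ ni|exact: L_zero_cj].
pose g n := complex.Re (chi i n).
have gE n : chi i n = (g n)%:C.
  have : chi i n \is Num.real by apply/CrealP; rewrite -(dchar_cj chiP) cji.
  by move/complex_realP => [r rE]; rewrite /g rE.
have g_norm n : `|g n| = (coprime n N)%:R.
  apply: (@complexI R); rewrite -normc_real -gE -complex_norm_normc rmorph_nat.
  have [cn|/(dchar0 chiP) ->] := boolP (coprime n N); last by rewrite normr0.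
  exact: (dchar_norm chiP).
have sumE a b : (\sum_(a <= n < b) g n)%:C = \sum_(a <= n < b) chi i n.
  by rewrite rmorph_sum; apply: eq_bigr => n _; rewrite gE.
apply: (@real_char_nonvanishing R g _ _ _ B (2 * B)).
- by apply: complexI; rewrite -gE (dchar1 chiP) rmorph1.
- by move=> m n; apply: complexI; rewrite rmorphM /= -!gE (dcharM chiP).
- move=> n; have := g_norm n; case: (coprime n N) => /eqP; last first.
    by rewrite normr_eq0 => /eqP; constructor.
  by rewrite eqr_norml ler01 andbT => /orP[] /eqP; [constructor 2|constructor 3].
- by rewrite !mulr_ge0.
- by move=> a b; rewrite -normc_real sumE dchar_partial_bound.
- move=> x x0; have := Zi x 1%N x0 isT; rewrite divn1 div1r.
  suff -> : recip_sum (chi i) x = (\sum_(1 <= n < x.+1) g n / n%:R)%:C by rewrite normc_real.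
  by rewrite /recip_sum rmorph_sum; apply: eq_bigr => n _; rewrite gE rmorphM.
Qed.

Lemma class_sum_unbounded a : coprime a N ->
  exists K : R, forall x, (0 < x)%N -> ln x%:R - K <= #|I|%:R * class_sum a x.
Proof.
move=> ca; have [K KP] := class_sum_estimate; have [c cP] := coprime_sum_ge.
exists (K + c) => x x0; have := KP a x ca x0; have := cP x x0.
rewrite big1 ?mul0r ?addr0 => [|i ni]; last first.
  by rewrite (asboolF (L_nonzero ni)) mulr0.
rewrite normc_real ler_norml => ? /andP[? _]; lra.
Qed.
End Dirichlet.

(** Without primes beyond Q in the class, [class_sum] would be bounded, although |I| times it is at
    least ln x - K. *)
Theorem dirichlet (R : realType) (N a Q : nat) : (1 < N)%N -> coprime a N ->
  exists p, [/\ prime p, (Q < p)%N & (p = a %[mod N])%N].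
Proof.
move=> N1 ca; have [I [chi [i0 [cj chiP]]]] := dirichlet_chars_exist R[i] N1.
apply: contrapT => no_p.
have [K KP] := class_sum_unbounded N1 chiP ca.
pose M : R := 2 + \sum_(1 <= n < Q.+1) mangoldt R n / n%:R.
have [x x0 lnx] := ln_nat_unbounded (K + #|I|%:R * M).
have : class_sum R N a x <= M.
  apply: mangoldt_filter_le => n pn /eqP na; rewrite leqNgt; apply/negP => Qn.
  by apply: no_p; exists n.
move=> le1; have := KP x x0.
have : #|I|%:R * class_sum R N a x <= #|I|%:R * M by rewrite ler_wpM2l.
lra.
Qed.

(** * Ternary integers of height h or h + 1 *)

Lemma inverse_mod (a n : nat) : (0 < a)%N -> coprime a n ->
  exists b, (b * a = 1 %[mod n])%N.
Proof.
move=> a0 /(coprimeP _ a0)[[u v] /= E]; exists u.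
by have -> : (u * a = v * n + 1)%N; [lia|rewrite modnMDl].
Qed.

Lemma coprime_inverse_mod (a b n : nat) : (b * a = 1 %[mod n])%N -> coprime b n.
Proof.
move=> E; have : coprime (b * a) n by rewrite -coprime_modl E coprime_modl coprime1n.
by rewrite coprimeMl => /andP[].
Qed.

Lemma ternary_height_exists (R : realType) (h N : nat) : (0 < h)%N ->
  exists p q r, [/\ prime p, prime q, prime r, (N < p < q)%N && (q < r)%N &
    height (p * q * r) = h \/ height (p * q * r) = h.+1].
Proof.
move=> h0; have [p p_gt pp] := prime_above (maxn N (4 * h.+1 ^ 3)).
move: p_gt; rewrite gtn_max => /andP[Np ph].
have hp : (h.+1 < p)%N.
  by apply: leq_trans ph; rewrite ltnS (leq_trans _ (leq_pmull _ _)) // -{1}[h.+1]expn1 leq_exp2l.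
have small_coprime m s : prime s -> (0 < m < s)%N -> coprime m s.
  by move=> ps m0s; rewrite coprime_sym prime_coprime // gtnNdvd //; case/andP: m0s.
have hp' : (0 < h < p)%N by rewrite h0 ltnW.
have [a aE] := inverse_mod h0 (small_coprime h p pp hp').
have [q [pq qh qa]] := dirichlet R (h * h.+1 * p) (prime_gt1 pp) (coprime_inverse_mod aE).
have pq_lt : (p < q)%N by apply: leq_ltn_trans qh; rewrite leq_pmull // muln_gt0 h0.
have hh_lt : (0 < h * h.+1 < q)%N.
  rewrite muln_gt0 h0 /=; apply: leq_ltn_trans qh; rewrite leq_pmulr // prime_gt0 //.
have [b bE] := inverse_mod (proj1 (andP hh_lt)) (small_coprime _ q pq hh_lt).
have cpq : coprime p q by rewrite prime_coprime // dvdn_prime2 // ltn_eqF.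
(* The class of r modulo p q combines the inverse a of h modulo p with the inverse b of h (h + 1)
   modulo q. *)
pose c := chinese p q a b.
have cp : (c * h = 1 %[mod p])%N by rewrite -modnMml chinese_modl // modnMml.
have cq : (c * (h * h.+1) = 1 %[mod q])%N by rewrite -modnMml chinese_modr // modnMml.
have c_pq : coprime c (p * q).
  by rewrite coprimeMr (coprime_inverse_mod cp) (coprime_inverse_mod cq).
have pq1 : (1 < p * q)%N by rewrite (leq_trans (prime_gt1 pp)) // leq_pmulr ?prime_gt0.
have [r [pr r_gt rE]] := dirichlet R (p * q) pq1 c_pq.
exists p, q, r; split => //.
  by rewrite Np pq_lt /=; apply: leq_ltn_trans r_gt; rewrite leq_pmull ?prime_gt0.
have rp : (r = c %[mod p])%N by rewrite -(modn_dvdm r (dvdn_mulr q (dvdnn p))) rE modn_dvdm // dvdn_mulr.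
have rq : (r = c %[mod q])%N by rewrite -(modn_dvdm r (dvdn_mull p (dvdnn q))) rE modn_dvdm // dvdn_mull.
apply: height_ternary => //.
- by rewrite mulnC -modnMml qa modnMml.
- by rewrite -modnMml rp modnMml.
- by rewrite -modnMml rq modnMml.
Qed.

(** * The sparse set of primes *)

Lemma card_fset_set_le (T : choiceType) (A : set T) (s : seq T) :
  (forall x, A x -> x \in s) -> (#|` fset_set A| <= size s)%N.
Proof.
move=> As; have finA : finite_set A.
  by apply: (sub_finite_set (B := [set` s])) => //; exact: finite_seq.
apply: (@leq_trans #|` seq_fset tt s|); last by rewrite size_seq_fset size_undup.
apply: fsubset_leq_card; apply/fsubsetP => x; rewrite in_fset_set // seq_fsetE.
by move=> /set_mem/As.
Qed.

Theorem corollary1 (R : realType) :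
  exists P : set nat,
    [/\ (forall p : nat, P p -> prime p),
        (forall x : R, 1 < x -> (count_upto P x)%:R < ln x)
      & (forall (h : nat) (N : R), (0 < h)%N ->
          exists p q r : nat,
            [/\ P p /\ P q /\ P r,
                p <> q /\ p <> r /\ q <> r,
                N < p%:R /\ N < q%:R /\ N < r%:R
              & height (p * q * r)%N = h \/ height (p * q * r)%N = h.+1])].
Proof.
(* Stage k serves the pair coded by k, the first component being h - 1 so that every code gives h >=
   1; numbers that code no pair get (0, 0), which only adds a harmless triple. *)
pose target (k : nat) : nat * nat := odflt (0, 0)%N (choice.unpickle k).
have /choice[u uP] : forall k, exists t : nat * nat * nat,
    [/\ prime t.1.1, prime t.1.2, prime t.2,
      [/\ (3 * k.+1)%:R < ln (t.1.1%:R : R), ((target k).2 < t.1.1)%N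
        & (t.1.1 < t.1.2)%N && (t.1.2 < t.2)%N]
      & height (t.1.1 * t.1.2 * t.2) = (target k).1.+1 \/
        height (t.1.1 * t.1.2 * t.2) = (target k).1.+2].
  move=> k; have [n n0 lnn] := ln_nat_unbounded ((3 * k.+1)%:R : R).
  have [p [q [r [pp pq pr /andP[/andP[Np pq_lt] qr]]]]] :=
    ternary_height_exists R (maxn n (target k).2) (ltn0Sn (target k).1).
  move: Np; rewrite gtn_max => /andP[np tp] Hh.
  exists (p, q, r); split => //; split => //=; last by rewrite pq_lt.
  exact: lt_le_trans lnn (ler_ln_nat R (ltnW np)).
pose stage k : seq nat := [:: (u k).1.1; (u k).1.2; (u k).2].
have stage_ln k p : p \in stage k -> (3 * k.+1)%:R < ln (p%:R : R).
  have [_ _ _ [lt1 _ /andP[lt2 lt3]] _] := uP k.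
  rewrite !inE => /or3P[] /eqP ->; first exact: lt1.
    exact: lt_le_trans lt1 (ler_ln_nat R (ltnW lt2)).
  exact: lt_le_trans lt1 (ler_ln_nat R (ltnW (ltn_trans lt2 lt3))).
exists [set p | exists k, p \in stage k]; split.
- move=> p [k]; have [p1 p2 p3 _ _] := uP k.
  by rewrite !inE => /or3P[] /eqP ->.
- move=> x x1; have lnx0 : 0 < ln x by exact: ln_gt0.
  (* For the least such M, every element of a stage k >= M has logarithm above 3 (M + 1) >= ln x. At
     most 3 M elements remain, and 3 M < ln x by minimality, or by x > 1 if M = 0. *)
  have exM : exists M, ln x <= (3 * M.+1)%:R.
    exists (Num.bound (ln x)); apply: le_trans (ltW (archi_boundP (ltW lnx0))) _.
    by rewrite ler_nat; lia.
  case: (ex_minnP exM) => M M_ub M_min.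
  apply: (@le_lt_trans _ _ (size (flatten [seq stage k | k <- iota 0 M]))%:R).
    rewrite ler_nat; apply: card_fset_set_le => p /= [[k pk] px].
    apply/flattenP; exists (stage k) => //; apply: map_f; rewrite mem_iota add0n /= ltnNge.
    apply/negP => Mk; have lt1 := stage_ln k p pk.
    have le1 : ln (p%:R : R) <= ln x.
      have p0 : (0 < p)%N by case: p pk lt1 px => // _; rewrite ln0 // ltNge ler0n.
      by rewrite ler_ln ?posrE ?ltr0n // (lt_trans ltr01).
    have : (3 * M.+1)%:R <= (3 * k.+1)%:R :> R by rewrite ler_nat leq_mul2l.
    by have := M_ub; lra.
  rewrite size_flatten /shape -map_comp sumnE big_map.
  rewrite (eq_bigr (fun=> 3%N)) // big_const_seq count_predT size_iota iter_addn_0.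
  case: M M_ub M_min => [|M] _ M_min; first by rewrite muln0.
  by rewrite ltNge; apply/negP => /M_min; rewrite ltnn.
- move=> h N h0; pose k := choice.pickle (h.-1, Num.bound `|N|).
  have tk : target k = (h.-1, Num.bound `|N|) by rewrite /target choice.pickleK.
  have := uP k; rewrite tk /= prednK // => -[_ _ _ [_ lt1 /andP[lt2 lt3]] Hh].
  exists (u k).1.1, (u k).1.2, (u k).2; split => //.
  + by split; [|split]; exists k; rewrite !inE eqxx ?orbT.
  + by split; [|split]; lia.
  + have Np : N < (u k).1.1%:R.
      apply: le_lt_trans (ler_norm N) _; apply: lt_trans (archi_boundP (normr_ge0 N)) _.
      by rewrite ltr_nat.
    by split => //; split; apply: lt_trans Np _; rewrite ltr_nat // (ltn_trans lt2).
Qed.
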